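(* Let $p\in(0,1)$ be a constant and let $G_n\sim G(n,p)$. Let $X_n$ denote the maximum number of edges of a chordal subgraph of $G_n$. Let $\gamma=\gamma(p)$ be the unique solution in the interval $(\max\{1,2p\},2)$ of the equation $$\gamma\ln\frac{2}{\gamma}+(2-\gamma)\ln\frac{2}{2-\gamma}=(2-\gamma)\ln\frac{1}{1-p}-(1-\gamma)\ln\frac{1}{p}.$$ Then with probability tending to $1$ as $n\to\infty$, $$\left|X_n-\gamma\, n\log_{1/p} n\right|\leq 10\, n\log_{1/p}\ln n.$$
   Context: A graph is chordal if it contains no induced cycle of length at least 4. $G(n,p)$ is the binomial random graph on vertex set $[n]=\{1,\dots,n\}$ in which each pair is an edge independently with probability $p$. A subgraph here need not be induced. *)

(* Defs.v *)
From mathcomp Require Import all_boot all_order all_algebra.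
From mathcomp Require Import reals exp.
Set Implicit Arguments. Unset Strict Implicit. Unset Printing Implicit Defensive.
Import Order.TTheory GRing.Theory Num.Theory.
Local Open Scope ring_scope.

(* A simple graph on vertex set 'I_n (= [n]) is an edge set E of ordered
   pairs (i,j) with i < j, i.e. a subset of [edge_pairs n]. *)
Definition edge_pairs (n : nat) : {set 'I_n * 'I_n} := [set e : 'I_n * 'I_n | (e.1 < e.2)%N].

Definition adjb n (H : {set 'I_n * 'I_n}) (u v : 'I_n) : bool :=
  ((u, v) \in H) || ((v, u) \in H).

Definition cyc_adj k (i j : 'I_k) : bool :=
  (j == (i.+1 %% k)%N :> nat) || (i == (j.+1 %% k)%N :> nat).

Definition has_induced_cycle n (H : {set 'I_n * 'I_n}) : bool :=
  [exists k : 'I_n.+1, exists f : {ffun 'I_k -> 'I_n},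
     [&& (3 < k)%N, injectiveb f &
         [forall i : 'I_k, forall j : 'I_k, adjb H (f i) (f j) == cyc_adj i j]]].

Definition chordal n (H : {set 'I_n * 'I_n}) : bool := ~~ has_induced_cycle H.

Definition max_chordal n (E : {set 'I_n * 'I_n}) : nat :=
  \max_(H : {set 'I_n * 'I_n} | (H \subset E) && chordal H) #|H|.

Definition Gnp_prob (R : realType) (n : nat) (p : R)
    (A : pred {set 'I_n * 'I_n}) : R :=
  \sum_(E : {set 'I_n * 'I_n} | (E \subset edge_pairs n) && A E)
     p ^+ #|E| * (1 - p) ^+ (#|edge_pairs n| - #|E|).

(* Main.v *)
Require Import Defs.
From mathcomp Require Import all_boot all_order all_algebra.
From mathcomp Require Import boolp reals sequences exp.
From mathcomp Require Import zify ring lra.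
Set Implicit Arguments. Unset Strict Implicit. Unset Printing Implicit Defensive.
Import Order.TTheory GRing.Theory Num.Theory.

(* Write gamma = 2q and s = log_{1/p} n. The equation for gamma says that the
   relative entropy of q with respect to p is ln(1/p) / 2, that is,
   P(Bin(2s, p) >= gamma s) = 1/n up to polylogarithmic factors; 2s is the clique
   number of G(n,p) up to O(log log n).

   Upper bound. A chordal graph has a perfect elimination order (Dirac). Let pi(v)
   be the latest earlier neighbour of v: the earlier neighbours of v lie in the
   clique formed by pi(v) and the earlier neighbours of pi(v). Hence the number of
   edges is at most the sum of |N(v)| for the sets defined from G and pi alone by
   N(v) = {w in {pi(v)} U N(pi(v)) : vw in G}. Given the past, |N(v)| is binomial
   with at most about 2s trials, so for each of the at most (n+1)^n parent
   functions a Chernoff bound gives probability about n^{-n} that the sum exceeds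
   gamma s n, and a union bound concludes.

   Lower bound. Among the first n / ln n vertices a second moment computation finds
   n / polylog(n) disjoint cliques of size k = 2s - 9 log_{1/p} ln n. Each other
   vertex is attached to its neighbours in one of these cliques; with high
   probability some clique contains about q k of them, and the resulting graph is
   chordal. *)

(** * Perfect elimination orders *)

Section Dirac.
Variables (T : finType) (e : rel T).
Hypothesis e_sym : symmetric e.
Hypothesis e_irr : irreflexive e.

Definition hole_free :=
  forall k (f : 'I_k -> T), (3 < k)%N -> injective f ->
    ~ (forall i j, e (f i) (f j) = cyc_adj i j).

Definition simplicial (A : {set T}) (v : T) :=
  v \in A /\ {in A &, forall u w, e v u -> e v w -> u != w -> e u w}.

(** Only the values of [g] at 0, ..., m count; interior vertices must lie in [C], the endpoints may
    lie outside it. *)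
Definition walk (C : {set T}) (a b : T) (m : nat) (g : nat -> T) :=
  [/\ g 0%N = a, g m = b, forall i, (i < m)%N -> e (g i) (g i.+1) &
      forall i, (0 < i < m)%N -> g i \in C].

Lemma walk_shortcut (C : {set T}) a b m g i j :
  walk C a b m g -> (i.+1 < j <= m)%N -> e (g i) (g j) ->
  exists2 m', (m' < m)%N & exists g', walk C a b m' g'.
Proof.
move=> [g0 gm ge gC] /andP[ij jm] eij.
exists (m - (j - i.+1))%N; first lia.
exists (fun l => if (l <= i)%N then g l else g (l + (j - i.+1))%N); split => //.
- case: leqP => h; first lia.
  by rewrite -gm; congr g; lia.
- move=> l lm; case: (leqP l.+1 i) => h1.
    by rewrite ltnW //; apply: ge; lia.
  case: (leqP l i) => h2.
    have -> : l = i by lia.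
    by have -> : (i.+1 + (j - i.+1) = j)%N by lia.
  by rewrite addSn; apply: ge; lia.
- move=> l hl; case: leqP => h; apply: gC; lia.
Qed.

(** A shortest walk from [a] to [b] through [C] is an induced path, by [walk_shortcut]. As [x] sees
    both ends and nothing of the interior, it closes this path to a hole. *)
Lemma nonadjacent_walk (C : {set T}) x a b m g :
  hole_free -> walk C a b m g -> a != b -> ~~ e a b -> a \notin C -> b \notin C ->
  e x a -> e x b -> {in C, forall c, (c != x) && ~~ e x c} -> False.
Proof.
move=> hf wg0 ab nab aC bC xa xb Cx.
have : exists m, `[< exists g, walk C a b m g >].
  by exists m; apply/asboolP; exists g.
move=> /ex_minnP[{m g wg0}m /asboolP[g wg] mmin].
have short i j : (i.+1 < j <= m)%N -> e (g i) (g j) = false.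
  move=> hij; apply/negP => eij.
  have [m' m'm wm'] := walk_shortcut wg hij eij.
  have /mmin : `[< exists g, walk C a b m' g >] by apply/asboolP.
  by rewrite leqNgt m'm.
have [g0 gm ge gC] := wg.
have m2 : (2 <= m)%N.
  case: m {mmin short wg gC} gm ge => [|[|m]] // gm ge.
    by move: ab; rewrite -g0 gm eqxx.
  by move: nab; rewrite -g0 -gm ge.
have xg i : (i <= m)%N -> (x != g i) && (e x (g i) == ((i == 0%N) || (i == m))).
  move=> im; have [->|i0] := eqVneq i 0%N.
    rewrite g0 xa eqxx andbT; apply: contraTneq xa => ->; by rewrite e_irr.
  have [->|i1] := eqVneq i m.
    rewrite gm xb eqxx andbT; apply: contraTneq xb => ->; by rewrite e_irr.
  have /Cx : g i \in C by apply: gC; lia.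
  by rewrite eq_sym /= eqbF_neg.
have xne i : (i <= m)%N -> x <> g i.
  by move=> /xg /andP[/eqP].
have ginj i j : (i < j <= m)%N -> g i <> g j.
  move=> /andP[ij jm] gij.
  have [jlt|jm'] := ltnP j m.
    have := ge _ jlt; rewrite -gij short //; lia.
  have {jm jm'} ej : j = m by lia.
  subst j; case: i ij gij => [_|i ij] gij; first by rewrite -g0 gij gm eqxx in ab.
  by move: bC; rewrite -gm -gij gC //; lia.
have gadj i j : (i <= m)%N -> (j <= m)%N -> e (g i) (g j) = (j == i.+1) || (i == j.+1).
  wlog ij : i j / (i <= j)%N.
    move=> H im jm; have [/H|/ltnW/H] := leqP i j; first by apply.
    by rewrite e_sym orbC; apply.
  move=> im jm; have [->|nij] := eqVneq i j; first by rewrite e_irr; lia.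
  have [->|nij1] := eqVneq j i.+1; first by rewrite ge //; lia.
  rewrite short; lia.
(* The hole is [x] followed by [g 0], ..., [g m]; its length m + 2 is at least 4 because [a] and [b]
   are distinct and nonadjacent. *)
apply: (hf m.+2 (fun i : 'I_m.+2 => if val i is l.+1 then g l else x)).
- lia.
- move=> [[|i] hi] [[|j] hj] //= h; apply: val_inj => //=.
  + by case: (xne j).
  + by case: (xne i).
  congr S; apply/eqP; have [] // := ltngtP i j => hij.
    by case: (ginj i j); rewrite ?hij.
  by case: (ginj j i); rewrite ?hij.
have wrap l : (l < m.+2)%N -> (l.+1 %% m.+2 = if l == m.+1 then 0 else l.+1)%N.
  move=> hl; case: eqVneq => [->|h]; first by rewrite modnn.
  rewrite modn_small //; lia.
move=> [i hi] [j hj]; rewrite /cyc_adj /= !wrap //.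
case: i hi => [|i] hi; case: j hj => [|j] hj //=.
- have /andP[_ /eqP ->] : (x != g j) && (e x (g j) == ((j == 0%N) || (j == m))) by apply: xg; lia.
  by rewrite !eqSS; case: (j == m).
- rewrite e_sym.
  have /andP[_ /eqP ->] : (x != g i) && (e x (g i) == ((i == 0%N) || (i == m))) by apply: xg; lia.
  by rewrite !eqSS orbC; case: (i == m).
rewrite gadj; [|lia|lia].
rewrite !eqSS; have [->|] := eqVneq i m; have [->|] := eqVneq j m; lia.
Qed.

Lemma connect_walk (C : {set T}) a b c d :
  a \notin C -> c \in C -> e a c -> e d b ->
  connect [rel u v | e u v && (v \in C)] c d -> exists m g, walk C a b m g.
Proof.
move=> aC cC ac db /connectP[s pth dl].
have sC : all (mem C) (c :: s).
  rewrite /= cC /=; elim: s c {cC ac dl} pth => //= z s IH c /andP[/andP[_ ->] /IH].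
  by [].
have pe : path e a (rcons (c :: s) b).
  rewrite rcons_path /= ac -dl db andbT /=.
  by apply: sub_path pth => u v /andP[].
exists (size s).+2, (nth a (a :: rcons (c :: s) b)); split => //.
- by rewrite -[RHS](last_rcons a (c :: s) b) (last_nth a) size_rcons.
- by move=> i im; move/(pathP a): pe; apply; rewrite size_rcons.
- case=> // i im; rewrite -[nth _ _ _]/(nth a (rcons (c :: s) b) i) nth_rcons.
  have hi : (i < size (c :: s))%N by move: im => /=; lia.
  by rewrite hi; apply: (allP sC); rewrite mem_nth.
Qed.

(** Dirac's lemma, strengthened by a prescribed [x] to avoid so that induction on the size of [A]
    works: it passes to a component of the non-neighbours of [x] together with its boundary, a set
    that misses [x]. *)
Lemma hole_free_simplicial_avoiding (hf : hole_free) (A : {set T}) x :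
  x \in A -> (exists2 y, y \in A & (y != x) && ~~ e x y) ->
  exists2 v, simplicial A v & (v != x) && ~~ e x v.
Proof.
have [m] := ubnP #|A|; elim: m => // m IH in A x * => mA xA [y yA yx].
pose B := [set z in A | (z != x) && ~~ e x z].
pose rr := [rel u v | [&& e u v, u \in B & v \in B]].
have rr_sym : connect_sym rr.
  by apply: sym_connect_sym => u v /=; rewrite e_sym [(u \in B) && _]andbC.
(* The component of [y] among the non-neighbours of [x] in [A]. *)
pose C := [set z in B | connect rr y z].
have yB : y \in B by rewrite inE yA.
have yC : y \in C by rewrite inE yB connect0.
have CB z : z \in C -> z \in B by rewrite inE => /andP[].
have Cnb z w : z \in C -> w \in B -> e z w -> w \in C.
  move=> zC wB zw; rewrite inE wB; move: (zC); rewrite inE => /andP[zB yz].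
  by apply: connect_trans yz (connect1 _); rewrite /= zw zB.
(* The boundary of [C] in [A]. It consists of neighbours of [x], since a non-neighbour adjacent to
   [C] would belong to [C]; by [nonadjacent_walk] it is a clique. *)
pose S := [set a in A | (a \notin C) && [exists c in C, e c a]].
have Sx a : a \in S -> e x a.
  rewrite inE => /and3P[aA aC /exists_inP[c cC ca]].
  apply: contraNT aC => xa; apply: (Cnb _ _ cC _ ca); rewrite inE aA xa andbT.
  apply: contraTneq ca => ->; rewrite e_sym.
  by have := CB _ cC; rewrite inE => /and3P[].
have CC c d : c \in C -> d \in C -> connect [rel u v | e u v && (v \in C)] c d.
  move=> cC dC.
  have : connect rr c d.
    move: cC dC; rewrite !inE => /andP[_ yc] /andP[_ yd].
    by apply: connect_trans yd; rewrite rr_sym.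
  move=> /connectP[s]; elim: s c cC => [|z s IHs] c cC /=.
    by move=> _ ->.
  move=> /andP[/and3P[cz cB zB] /IHs h] dl.
  have zC : z \in C by apply: Cnb cz.
  apply: connect_trans (h zC dl); apply: connect1; by rewrite /= cz.
have Scl : {in S &, forall a b, a != b -> e a b}.
  move=> a b aS bS ab; apply/negPn/negP => nab.
  have := aS; have := bS.
  rewrite in_set => /and3P[bA bC /exists_inP[d dC db]].
  rewrite in_set => /and3P[aA aC /exists_inP[c cC ca]].
  rewrite e_sym in ca.
  have [k [g wg]] := connect_walk aC cC ca db (CC _ _ cC dC).
  apply: (nonadjacent_walk hf wg ab nab aC bC (Sx _ aS) (Sx _ bS)).
  by move=> z /CB; rewrite inE => /and3P[_ -> ->].
pose W := C :|: S.
have xW : x \notin W.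
  rewrite inE negb_or; apply/andP; split; apply/negP.
    by move/CB; rewrite inE eqxx andbF.
  by move/Sx; rewrite e_irr.
have WA : W \subset A.
  by apply/subsetP => z; rewrite !inE => /orP[/andP[/andP[]]|/andP[]].
have mW : (#|W| < m)%N.
  have : (#|W| < #|A|)%N.
    by apply: proper_card; apply/properP; split => //; exists x.
  by move: mA; lia.
(* All neighbours in [A] of a vertex of [C] lie in [W]. *)
have lift v : v \in C -> simplicial W v -> exists2 v, simplicial A v & (v != x) && ~~ e x v.
  move=> vC [vW sv]; exists v; last by have := CB _ vC; rewrite inE => /and3P[_ ->].
  have nb u : u \in A -> e v u -> u \in W.
    move=> uA vu; have [uC|uC] := boolP (u \in C); first by rewrite in_setU uC.
    by rewrite in_setU orbC in_set uA uC /=; apply/orP; left; apply/exists_inP; exists v.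
  split; first by apply: (subsetP WA).
  by move=> u w uA wA vu vw; apply: sv => //; apply: nb.
(* If some [s] in [S] misses a vertex of [W], induction with [s] in place of [x] gives a simplicial
   vertex nonadjacent to [s]; it is in [C], as [S] is a clique. *)
have [/existsP[s /existsP[z /and4P[sS zW zs nsz]]]|nS] :=
    boolP [exists s, exists z, [&& s \in S, z \in W, z != s & ~~ e s z]].
  have sW : s \in W by rewrite inE sS orbT.
  have [|v sv /andP[vs nsv]] := IH W s mW sW; first by exists z; rewrite ?zs.
  apply: (lift v) => //; have := sv.1; rewrite inE => /orP[//|vS].
  by rewrite Scl // eq_sym in nsv.
have Suniv s z : s \in S -> z \in W -> z != s -> e s z.
  move=> sS zW zs; apply: contraNT nS => nsz.
  by apply/existsP; exists s; apply/existsP; exists z; rewrite sS zW zs nsz.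
(* Now [S] is joined to all of [W], so a simplicial vertex avoiding some [c] in [C] again lies in
   [C]. *)
have [/existsP[c /existsP[z /and4P[cC zW zc ncz]]]|nC] :=
    boolP [exists c, exists z, [&& c \in C, z \in W, z != c & ~~ e c z]].
  have cW : c \in W by rewrite inE cC.
  have [|v sv /andP[vc ncv]] := IH W c mW cW; first by exists z; rewrite ?zc.
  apply: (lift v) => //; have := sv.1; rewrite inE => /orP[//|vS].
  by rewrite e_sym Suniv // eq_sym in ncv.
(* In the remaining case [W] is a clique. *)
apply: (lift y yC); split; first by rewrite inE yC.
move=> u w uW wW _ _ uw; move: (uW); rewrite inE => /orP[uC|uS].
  apply: contraNT nC => nuw.
  by apply/existsP; exists u; apply/existsP; exists w; rewrite uC wW eq_sym uw nuw.
by apply: Suniv => //; rewrite eq_sym.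
Qed.

Lemma hole_free_simplicial (hf : hole_free) (A : {set T}) :
  A != set0 -> exists v, simplicial A v.
Proof.
move=> /set0Pn[x xA].
have [/existsP[u /existsP[w /and4P[uA wA wu nuw]]]|nA] :=
    boolP [exists c, exists z, [&& c \in A, z \in A, z != c & ~~ e c z]].
  have [|v sv _] := hole_free_simplicial_avoiding hf uA; last by exists v.
  by exists w; rewrite ?wu.
exists x; split=> // u w uA wA _ _ uw; apply: contraNT nA => nuw.
by apply/existsP; exists u; apply/existsP; exists w; rewrite uA wA eq_sym uw nuw.
Qed.

(** A simplicial vertex is placed last and the others are ordered by induction; [r] is the
    position. *)
Lemma perfect_elimination_order (hf : hole_free) :
  exists2 r : T -> nat, injective r & forall v, (r v < #|T|)%N /\
    forall u w, (r u < r v)%N -> (r w < r v)%N -> e v u -> e v w -> u != w -> e u w.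
Proof.
suff H (A : {set T}) : exists2 r : T -> nat, {in A &, injective r} &
    {in A, forall v, (r v < #|A|)%N /\ {in A &, forall u w,
      (r u < r v)%N -> (r w < r v)%N -> e v u -> e v w -> u != w -> e u w}}.
  have [r ri rA] := H setT; exists r; first by move=> u v; apply: ri; rewrite inE.
  move=> v; have [|h1 h2] := rA v; first by rewrite inE.
  by split=> [|u w]; [rewrite -cardsT | apply: h2; rewrite inE].
have [m] := ubnP #|A|; elim: m => // m IH in A * => mA.
have [->|A0] := eqVneq A set0.
  by exists (fun=> 0%N) => [u v|u]; rewrite inE.
have [v [vA sv]] := hole_free_simplicial hf A0.
have cA := cardsD1 v A; rewrite vA in cA.
have [|r ri rA] := IH (A :\ v); first by lia.
have rlt u : u \in A -> u != v -> (r u < #|A :\ v|)%N.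
  by move=> uA uv; have [|//] := rA u; rewrite !inE uv.
exists (fun u => if u == v then #|A :\ v| else r u).
  move=> u w uA wA; have [->|uv] := eqVneq u v; have [->|wv] := eqVneq w v => //.
  - by have := rlt _ wA wv; lia.
  - by have := rlt _ uA uv; lia.
  by apply: ri; rewrite !inE ?uv ?wv.
move=> u uA; split.
  by case: eqVneq => [_|uv]; [lia | have := rlt _ uA uv; lia].
move=> a b aA bA; have [->|uv] := eqVneq u v.
  by move=> _ _; apply: sv.
have [_|av] := eqVneq a v; first by rewrite ltnNge (ltnW (rlt _ uA uv)).
have [_|bv] := eqVneq b v; first by move=> _; rewrite ltnNge (ltnW (rlt _ uA uv)).
have [|_ h] := rA u; first by rewrite !inE uv.
by apply: h; rewrite !inE ?av ?bv.
Qed.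

End Dirac.

(** * Product measure on subsets *)

Local Open Scope ring_scope.

Section RandomSubset.
Variables (R : realType) (T : finType) (p : R).
Implicit Types (F G S J : {set T}) (h : {set T} -> R) (A : pred {set T}).

Definition wt F : R := \prod_e (if e \in F then p else 1 - p).
Definition Ex h : R := \sum_F wt F * h F.
Definition Pr A : R := Ex (fun F => (A F)%:R).

(** Independence of the coordinates, in the form from which the exact trace probabilities and
    generating functions below are computed. *)
Lemma Ex_prod (phi : T -> bool -> R) :
  Ex (fun F => \prod_e phi e (e \in F)) =
  \prod_e (p * phi e true + (1 - p) * phi e false).
Proof.
rewrite bigA_distr; apply: eq_bigr => F _; rewrite -big_split /=.
by apply: eq_bigr => e _; case: ifP.
Qed.

Lemma Ex_cst (c : R) : Ex (fun=> c) = c.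
Proof.
have -> : Ex (fun=> c) = Ex (fun F => \prod_(e : T) 1) * c.
  by rewrite /Ex mulr_suml; apply: eq_bigr => F _; rewrite big1 // mulr1.
rewrite (Ex_prod (fun _ _ => 1)) big1 ?mul1r // => e _.
by rewrite !mulr1 addrC subrK.
Qed.

Lemma eq_Ex h1 h2 : h1 =1 h2 -> Ex h1 = Ex h2.
Proof. by move=> eh; apply: eq_bigr => F _; rewrite eh. Qed.

Lemma ExD h1 h2 : Ex (fun F => h1 F + h2 F) = Ex h1 + Ex h2.
Proof. by rewrite -big_split; apply: eq_bigr => F _; rewrite mulrDr. Qed.

Lemma ExZ c h : Ex (fun F => c * h F) = c * Ex h.
Proof. by rewrite mulr_sumr; apply: eq_bigr => F _; rewrite mulrCA. Qed.

Lemma Ex_sum (I : finType) (P : pred I) (h : I -> {set T} -> R) :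
  Ex (fun F => \sum_(i | P i) h i F) = \sum_(i | P i) Ex (h i).
Proof.
by rewrite exchange_big; apply: eq_bigr => F _; rewrite mulr_sumr.
Qed.

Definition mix S F G : {set T} := (F :&: S) :|: (G :\: S).

Lemma in_mix S F G e : (e \in mix S F G) = if e \in S then e \in F else e \in G.
Proof. by rewrite !inE; case: (e \in S); rewrite ?andbT ?andbF ?orbF. Qed.

(* Resampling the coordinates outside [S]: exchanging them between two
   independent copies preserves the joint weight. *)
Lemma Ex_mix S h : Ex h = Ex (fun F => Ex (fun G => h (mix S F G))).
Proof.
pose sw (x : {set T} * {set T}) := (mix S x.1 x.2, mix S x.2 x.1).
have swK : involutive sw.
  move=> [F G]; rewrite /sw /=; congr pair; apply/setP => e;
  by rewrite !in_mix; case: (e \in S).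
have wtsw x : wt (sw x).1 * wt (sw x).2 = wt x.1 * wt x.2.
  rewrite /wt -!big_split; apply: eq_bigr => e _ /=; rewrite !in_mix.
  by case: (e \in S) => //; rewrite mulrC.
have -> : Ex h = \sum_x wt x.1 * wt x.2 * h x.1.
  rewrite -(pair_bigA _ (fun F G => wt F * wt G * h F)) /=.
  apply: eq_bigr => F _; rewrite -[LHS](Ex_cst (wt F * h F)).
  by apply: eq_bigr => G _; ring.
rewrite (reindex_inj (inv_inj swK)) /=.
under eq_bigr do rewrite wtsw.
rewrite -(pair_bigA _ (fun F G => wt F * wt G * h (mix S F G))) /=.
apply: eq_bigr => F _; rewrite mulr_sumr; apply: eq_bigr => G _; ring.
Qed.

(** The generating function of the binomial law of the size of the trace on [J]. *)
Lemma Ex_exp (z : R) J : Ex (fun F => z ^+ #|F :&: J|) = (1 - p + p * z) ^+ #|J|.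
Proof.
have -> : Ex (fun F => z ^+ #|F :&: J|) =
    Ex (fun F => \prod_e (if e \in J then if e \in F then z else 1 else 1)).
  apply: eq_Ex => F; rewrite -big_mkcond /= -big_mkcondr /= prodr_const.
  by congr (_ ^+ _); apply: eq_card => e; rewrite !inE andbC.
rewrite (Ex_prod (fun e b => if e \in J then if b then z else 1 else 1)).
rewrite -prodr_const [RHS]big_mkcond; apply: eq_bigr => e _.
by case: ifP => _; ring.
Qed.

Lemma Pr_trace S J : J \subset S ->
  Pr (fun F => F :&: S == J) = p ^+ #|J| * (1 - p) ^+ (#|S| - #|J|).
Proof.
move=> JS.
have -> : Pr (fun F => F :&: S == J) =
    Ex (fun F => \prod_e (if e \in S then ((e \in F) == (e \in J))%:R else 1)).
  apply: eq_Ex => F; have [/eqP <-|FJ] := boolP (F :&: S == J).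
    rewrite big1 // => e _; rewrite inE; case: (e \in S) => //.
    by rewrite andbT eqxx.
  apply/esym/eqP; rewrite prodf_seq_eq0; apply/hasP.
  have /existsP[e he] : [exists e, (e \in F :&: S) != (e \in J)].
    rewrite -negb_forall; apply: contra FJ => /forallP h.
    by apply/eqP/setP => e; apply/eqP.
  exists e; first by rewrite mem_index_enum.
  move: he; rewrite inE /=; have [eS|eS] := boolP (e \in S).
    by rewrite andbT => /negbTE ->.
  by rewrite andbF (contraNF (subsetP JS e) eS).
rewrite (Ex_prod (fun e b => if e \in S then (b == (e \in J))%:R else 1)).
have -> : (#|S| - #|J|)%N = #|S :\: J|.
  by rewrite cardsD (setIidPr JS).
rewrite -!prodr_const [X in X * _]big_mkcond [X in _ * X]big_mkcond -big_split.
apply: eq_bigr => e _ /=; rewrite in_setD.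
have [eJ|eJ] := boolP (e \in J); first by rewrite (subsetP JS _ eJ) /=; ring.
by case: (e \in S) => /=; ring.
Qed.

Lemma Pr_sub S : Pr (fun F => S \subset F) = p ^+ #|S|.
Proof.
have := Pr_trace (subxx S); rewrite subnn expr0 mulr1 => <-.
by apply: eq_Ex => F; rewrite (sameP setIidPr eqP).
Qed.

Lemma Pr_card S (j : nat) :
  Pr (fun F => #|F :&: S| == j) = ('C(#|S|, j))%:R * p ^+ j * (1 - p) ^+ (#|S| - j).
Proof.
rewrite -cards_draws -mulrA mulr_natl -sumr_const.
have -> : Pr (fun F => #|F :&: S| == j) =
   Ex (fun F => \sum_(J in [set A : {set T} | A \subset S & #|A| == j]) (F :&: S == J)%:R).
  apply: eq_Ex => F; have [hj|hj] := boolP (_ == j).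
    rewrite (bigD1 (F :&: S)) ?inE ?subsetIr //= eqxx big1 ?addr0 // => J /andP[_].
    by rewrite eq_sym => /negbTE ->.
  rewrite big1 // => J; rewrite inE => /andP[_ /eqP Jj]; case: eqP => // FJ.
  by rewrite FJ Jj eqxx in hj.
rewrite Ex_sum; apply: eq_bigr => J; rewrite inE => /andP[JS /eqP Jj].
by have := Pr_trace JS; rewrite Jj.
Qed.

Hypothesis p01 : 0 <= p <= 1.

Lemma wt_ge0 F : 0 <= wt F.
Proof. by have /andP[p0 p1] := p01; apply: prodr_ge0 => e _; case: ifP => _; lra. Qed.

Lemma Ex_le h1 h2 : (forall F, h1 F <= h2 F) -> Ex h1 <= Ex h2.
Proof. by move=> hh; apply: ler_sum => F _; rewrite ler_wpM2l ?wt_ge0. Qed.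

Lemma Ex_ge0 h : (forall F, 0 <= h F) -> 0 <= Ex h.
Proof. by move=> hh; apply: sumr_ge0 => F _; rewrite mulr_ge0 ?wt_ge0. Qed.

Lemma Pr_le A1 A2 : (forall F, A1 F -> A2 F) -> Pr A1 <= Pr A2.
Proof. by move=> h; apply: Ex_le => F; rewrite ler_nat; have := h F; case: (A1 F) => // ->. Qed.

Lemma Pr_ge0 A : 0 <= Pr A.
Proof. by apply: Ex_ge0 => F; rewrite ler0n. Qed.

Lemma Pr_le_or A A1 A2 : (forall F, A F -> A1 F || A2 F) -> Pr A <= Pr A1 + Pr A2.
Proof.
move=> h; rewrite -ExD; apply: Ex_le => F; rewrite -natrD ler_nat.
by have := h F; case: (A F) => [/(_ isT)|_]; case: (A1 F); case: (A2 F).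
Qed.

Lemma Pr_compl A : Pr (fun F => ~~ A F) = 1 - Pr A.
Proof.
rewrite -[X in X - _](Ex_cst 1); apply/eqP; rewrite eq_sym subr_eq -ExD.
by apply/eqP/eq_Ex => F; case: (A F); rewrite ?addr0 ?add0r.
Qed.

Lemma Pr_exists (I : finType) (P : pred I) (B : I -> pred {set T}) :
  Pr (fun F => [exists i, P i && B i F]) <= \sum_(i | P i) Pr (B i).
Proof.
rewrite -Ex_sum; apply: Ex_le => F.
have [/existsP[i /andP[Pi BiF]]|_] := boolP [exists i, P i && B i F]; last first.
  by apply: sumr_ge0 => i _; rewrite ler0n.
by rewrite (bigD1 i) //= BiF lerDl; apply: sumr_ge0 => j _; rewrite ler0n.
Qed.

Lemma markov h (c : R) : (forall F, 0 <= h F) -> 0 < c ->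
  Pr (fun F => c <= h F) <= Ex h / c.
Proof.
move=> h0 c0; rewrite ler_pdivlMr // mulrC -ExZ; apply: Ex_le => F.
by have [hc|_] := boolP (c <= h F); rewrite ?mulr1 // mulr0.
Qed.

(** Events read off disjoint blocks of coordinates are independent; one block is split off at a time
    by resampling everything outside it. *)
Lemma Pr_all_blocks (I : eqType) (s : seq I) (B : I -> {set T})
    (A : I -> pred {set T}) (c : R) : 0 <= c -> uniq s ->
  {in s &, forall i j, i != j -> [disjoint B i & B j]} ->
  {in s, forall i F G, F :&: B i = G :&: B i -> A i F = A i G} ->
  {in s, forall i, Pr (A i) <= c} ->
  Pr (fun F => all (fun i => A i F) s) <= c ^+ size s.
Proof.
move=> c0; elim: s => [|i s IH] /=; first by rewrite expr0 /Pr /= Ex_cst.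
move=> /andP[si us] dis loc Ac.
have is_ j : j \in s -> i != j by move=> js; apply: contraNneq si => ->.
have {}IH : Pr (fun F => all (fun i => A i F) s) <= c ^+ size s.
  apply: (IH us) => [j k js ks|j js|j js].
  - by apply: dis; rewrite inE ?js ?ks orbT.
  - by apply: loc; rewrite inE js orbT.
  - by apply: Ac; rewrite inE js orbT.
have -> : Pr (fun F => A i F && all (fun i => A i F) s)
    = Ex (fun F => (A i F)%:R * Ex (fun G => (all (fun i => A i G) s)%:R)).
  rewrite /Pr (Ex_mix (B i)); apply: eq_Ex => F; rewrite -ExZ; apply: eq_Ex => G.
  have -> : A i (mix (B i) F G) = A i F.
    apply: loc; rewrite ?mem_head //; apply/setP => e; rewrite !in_setI in_mix.
    by case: (e \in B i); rewrite ?andbF ?andbT.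
  rewrite -natrM mulnb; congr ((_ && _)%:R).
  apply: eq_in_all => j js; apply: loc; first by rewrite inE js orbT.
  have /pred0P dij : [disjoint B i & B j].
    by apply: dis; rewrite ?mem_head ?inE ?js ?orbT ?is_.
  apply/setP => e; have := dij e; rewrite /= !in_setI in_mix.
  by case: (e \in B i); case: (e \in B j); rewrite ?andbF ?andbT.
rewrite exprS (_ : Ex _ = Pr (fun F => all (fun i => A i F) s) * Pr (A i)).
  by rewrite mulrC ler_pM ?Pr_ge0 ?Ac ?mem_head.
by rewrite -ExZ; apply: eq_Ex => F; rewrite mulrC.
Qed.

End RandomSubset.

(** * Parent functions and the exponential moment *)

Section Graph.
Variable n : nat.
Implicit Types (u v w : 'I_n) (F G H : {set 'I_n * 'I_n}).

Definition edge u v : 'I_n * 'I_n := if (u < v)%N then (u, v) else (v, u).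
(** [F] may be any set of ordered pairs: only the increasing pair on [u] and [v] is read. *)
Definition adj F : rel 'I_n := fun u v => (u != v) && (edge u v \in F).
Definition star v : {set 'I_n * 'I_n} := [set e | (e.1 == v) || (e.2 == v)].

Lemma edgeC u v : edge u v = edge v u.
Proof. by rewrite /edge; case: ltngtP => // /val_inj ->. Qed.

Lemma adj_sym F : symmetric (adj F).
Proof. by move=> u v; rewrite /adj eq_sym edgeC. Qed.

Lemma edge_inj v : injective (edge v).
Proof.
move=> u w; rewrite /edge; case: ifP => h1; case: ifP => h2 => -[] //.
  by move=> <- ->; apply/esym.
by move=> -> ->.
Qed.

Lemma edge_star u v w : (edge u w \in star v) = (u == v) || (w == v).
Proof. by rewrite inE /edge; case: ifP => //=; rewrite orbC. Qed.

Lemma edge_pair u v : u != v -> edge u v \in edge_pairs n.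
Proof.
move=> uv; rewrite inE /edge; have [//|//|/val_inj e] := ltngtP u v.
by rewrite e eqxx in uv.
Qed.

Lemma edge_pairE (e : 'I_n * 'I_n) : e \in edge_pairs n -> edge e.1 e.2 = e.
Proof. by case: e => u v; rewrite inE /edge /= => ->. Qed.

Lemma adjb_edge H u v : H \subset edge_pairs n ->
  adjb H u v = (u != v) && (edge u v \in H).
Proof.
move=> Hp; have Hlt x y : (x, y) \in H -> (x < y)%N.
  by move/(subsetP Hp); rewrite inE.
rewrite /adjb /edge; have [->|uv] /= := eqVneq u v.
  by rewrite orbb; apply/negP => /Hlt; rewrite ltnn.
case: ltngtP => h.
- by rewrite orbC; case: (boolP (_ \in _)) => // /Hlt; lia.
- by case: (boolP (_ \in _)) => // /Hlt; lia.
by rewrite (val_inj h) eqxx in uv.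
Qed.

Lemma chordal_hole_free H : chordal H -> hole_free (adjb H).
Proof.
move=> /negP cH k f k3 fi fc; apply: cH.
have kn : (k < n.+1)%N.
  by rewrite ltnS; have := leq_card f fi; rewrite !card_ord.
apply/existsP; exists (Ordinal kn); apply/existsP; exists (finfun f).
apply/and3P; split => //; first by apply/injectiveP => i j; rewrite !ffunE => /fi.
by apply/forallP => i; apply/forallP => j; rewrite !ffunE fc.
Qed.

(* [Nb a kappa pi t v] unrolls [t] times the recursion
   N(v) = {w in {pi v} U N(pi v) | a v w}, cut off at cliques of size > kappa. *)
Fixpoint Nb (a : rel 'I_n) (kappa : nat) (pi : 'I_n -> option 'I_n) (t : nat)
    (v : 'I_n) : {set 'I_n} :=
  if t is t'.+1 then
    if pi v is Some u then
      let K := u |: Nb a kappa pi t' u in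
      if (#|K| <= kappa)%N then [set w in K | a v w] else set0
    else set0
  else set0.

Lemma NbS a kappa pi t v : Nb a kappa pi t.+1 v =
    if pi v is Some u then
      let K := u |: Nb a kappa pi t u in
      if (#|K| <= kappa)%N then [set w in K | a v w] else set0
    else set0.
Proof. by []. Qed.

Definition parent_closed (pi : 'I_n -> option 'I_n) (U : {set 'I_n}) :=
  forall v u, v \in U -> pi v = Some u -> u \in U.

(** The recursion for N(v) follows the ancestors of [v], so it reads only pairs inside a
    parent-closed set. This will make the other sets insensitive to the edges at a last vertex. *)
Lemma Nb_local a b kappa pi U t v :
  parent_closed pi U -> {in U &, a =2 b} -> v \in U ->
  Nb a kappa pi t v = Nb b kappa pi t v /\ Nb a kappa pi t v \subset U.
Proof.
move=> Upi ab; elim: t v => [|t IH] v vU; first by rewrite sub0set.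
rewrite !NbS; case pv : (pi v) => [u|]; last by rewrite sub0set.
have uU := Upi _ _ vU pv; have [<- NU] := IH u uU.
have KU : u |: Nb a kappa pi t u \subset U by rewrite subUset sub1set uU.
rewrite /=; case: leqP => _; last by rewrite sub0set.
split; last by apply/subsetP => w; rewrite inE => /andP[/(subsetP KU)].
apply/setP => w; rewrite [LHS]inE [RHS]inE.
by case: (boolP (w \in _)) => //= /(subsetP KU) wU; rewrite ab.
Qed.

(** N(v) is cut out of a clique by adjacency to [v]. Hence in a graph without cliques larger than
    [kappa] the cut-off in [Nb] never acts. *)
Lemma Nb_clique a kappa pi t v : symmetric a ->
  {in v |: Nb a kappa pi t v &, forall u w, u != w -> a u w}.
Proof.
move=> a_sym; elim: t v => [|t IH] v.
  by move=> u w; rewrite !inE !orbF => /eqP -> /eqP ->; rewrite eqxx.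
have [K clK NK] : exists2 K : {set 'I_n}, {in K &, forall u w, u != w -> a u w} &
    Nb a kappa pi t.+1 v \subset [set w in K | a v w].
  rewrite NbS; case: (pi v) => [u|]; last first.
    by exists set0 => [u w|]; rewrite ?inE ?sub0set.
  by exists (u |: Nb a kappa pi t u) => //=; case: leqP; rewrite ?sub0set.
move=> u w; rewrite !in_setU1.
move=> /orP[/eqP ->|/(subsetP NK)uN] /orP[/eqP ->|/(subsetP NK)wN].
- by rewrite eqxx.
- by move: wN; rewrite inE => /andP[].
- by move: uN; rewrite inE a_sym => /andP[].
by move: uN wN; rewrite !inE => /andP[uK _] /andP[wK _]; apply: clK.
Qed.

Definition acyclic (pi : 'I_n -> option 'I_n) :=
  [exists r : {ffun 'I_n -> 'I_n},
     [forall v, if pi v is Some u then (r u < r v)%N else true]].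

(** The parent of a vertex is its latest earlier neighbour in a perfect elimination order of [H].
    Each edge of [H] is counted at its later endpoint, and the earlier [H]-neighbours of [v] lie in
    N(v). *)
Lemma chordal_card_le F H kappa : H \subset F :&: edge_pairs n -> chordal H ->
  (forall K : {set 'I_n}, {in K &, forall u w, u != w -> adj F u w} -> (#|K| <= kappa)%N) ->
  exists2 pi : {ffun 'I_n -> option 'I_n}, acyclic pi &
    (#|H| <= \sum_v #|Nb (adj F) kappa pi n v|)%N.
Proof.
rewrite subsetI => /andP[HF Hp] cH clF.
have adjH u v := adjb_edge u v Hp.
have Hsym : symmetric (adjb H) by move=> u v; rewrite !adjH eq_sym edgeC.
have Hirr : irreflexive (adjb H) by move=> u; rewrite adjH eqxx.
have [r r_inj rP] := perfect_elimination_order Hsym Hirr (chordal_hole_free cH).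
have rn v : (r v < n)%N by have [] := rP v; rewrite card_ord.
pose B v := [set u | adjb H v u && (r u < r v)%N].
pose pi : {ffun 'I_n -> option 'I_n} :=
  [ffun v => [pick u in B v | [forall w in B v, (r w <= r u)%N]]].
have piS v u : pi v = Some u -> u \in B v /\ {in B v, forall w, (r w <= r u)%N}.
  rewrite ffunE; case: pickP => // x /andP[xB /forall_inP xm] [<-].
  by split.
have piN v : pi v = None -> B v = set0.
  rewrite ffunE; case: pickP => // hn _; apply/eqP; apply: contraT => /set0Pn[u0 u0B].
  have := hn [arg max_(u > u0 in B v) r u]; case: arg_maxnP => // u uB um.
  by rewrite uB => /negbT/forall_inP[]; move=> w /um.
exists pi.
  apply/existsP; exists [ffun v => Ordinal (rn v)]; apply/forallP => v.
  case pv : (pi v) => [u|//]; have [] := piS _ _ pv.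
  by rewrite !ffunE inE => /andP[].
(* An earlier neighbour of [v] other than the parent [u] precedes [u] and is adjacent to it by the
   elimination order, so induction on the position applies to [u]. Positions are below [n], hence
   [n] unrollings suffice. *)
have BN t v : (r v < t)%N -> B v \subset Nb (adj F) kappa pi t v.
  elim: t v => // t IH v vt; rewrite NbS; case pv : (pi v) => [u|]; last first.
    by rewrite piN ?sub0set.
  have [uB um] := piS _ _ pv; move: (uB); rewrite inE => /andP[vu ruv].
  have BK : B v \subset u |: Nb (adj F) kappa pi t u.
    apply/subsetP => w wB; rewrite in_setU1; have [//|wu] := eqVneq w u.
    apply: (subsetP (IH u _)); first by lia.
    move: (wB); rewrite !inE => /andP[vw rwv]; have [_ h] := rP v.
    rewrite h // 1?eq_sym //= ltn_neqAle um // andbT.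
    by apply: contra wu => /eqP /r_inj ->.
  rewrite /= clF; last by apply: Nb_clique; apply: adj_sym.
  apply/subsetP => w wB; rewrite in_set (subsetP BK) //=.
  by move: wB; rewrite inE adjH => /andP[/andP[vw vwH] _]; rewrite /adj vw (subsetP HF).
pose P := [set x : 'I_n * 'I_n | x.2 \in B x.1].
have HP : H \subset [set edge x.1 x.2 | x in P].
  apply/subsetP => e eH; have ee := edge_pairE (subsetP Hp _ eH).
  have e12 : e.1 != e.2.
    by have := subsetP Hp _ eH; rewrite inE; apply: contraTneq => ->; rewrite ltnn.
  have ad : adjb H e.1 e.2 by rewrite adjH e12 ee.
  have [h|h|/r_inj h] := ltngtP (r e.1) (r e.2).
  - apply/imsetP; exists (e.2, e.1); last by rewrite /= edgeC.
    by rewrite !inE /= Hsym ad.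
  - by apply/imsetP; exists (e.1, e.2); rewrite ?ee // !inE /= ad.
  by rewrite h eqxx in e12.
apply: leq_trans (subset_leq_card HP) _; apply: leq_trans (leq_imset_card _ _) _.
have -> : #|P| = (\sum_v #|B v|)%N.
  rewrite -sum1_card (eq_bigl (fun x => xpredT x.1 && (x.2 \in B x.1))); last first.
    by move=> x; rewrite inE.
  rewrite -(pair_big_dep xpredT (fun v u => u \in B v) (fun _ _ => 1%N)) /=.
  by apply: eq_bigr => v _; rewrite sum1_card.
by apply: leq_sum => v _; apply/subset_leq_card/BN.
Qed.

(** * Exponential moment of the sum of the sizes |N(v)| *)

Section Moment.
Variables (R : realType) (p z : R).
Hypothesis p01 : 0 <= p <= 1.
Hypothesis z1 : 1 <= z.

Lemma card_edge_trace G v (K : {set 'I_n}) :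
  #|[set w in K | edge v w \in G]| = #|G :&: [set edge v w | w in K]|.
Proof.
rewrite -(card_imset _ (@edge_inj v)); apply: eq_card => e; rewrite inE.
apply/imsetP/andP => [[w]|[eG /imsetP[w wK ew]]].
  by rewrite inE => /andP[wK wG] ->; split => //; apply/imsetP; exists w.
by exists w; rewrite // inE wK -ew.
Qed.

(** The edges at a vertex of maximal rank are revealed last. Given all others, its |N(v)| is
    binomial with at most [kappa] trials, or zero, and contributes at most one factor to the power
    [kappa]. Induction runs over parent-closed sets. *)
Lemma Nb_moment (pi : 'I_n -> option 'I_n) kappa t : acyclic pi ->
  Ex p (fun F => \prod_v z ^+ #|Nb (adj F) kappa pi t v|)
    <= (1 - p + p * z) ^+ (kappa * n).
Proof.
have [/andP[p0 p1] c1] : 0 <= p <= 1 /\ 1 <= 1 - p + p * z.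
  split => //; have /andP[p0 p1] := p01.
  have : 0 <= p * (z - 1) by rewrite mulr_ge0 ?subr_ge0.
  lra.
rewrite /acyclic => /existsP[r /forallP rP].
suff H (U : {set 'I_n}) : parent_closed pi U ->
    Ex p (fun F => \prod_(v in U) z ^+ #|Nb (adj F) kappa pi t v|)
      <= (1 - p + p * z) ^+ (kappa * #|U|).
  have /H : parent_closed pi setT by move=> v u; rewrite !inE.
  rewrite cardsT card_ord => h.
  rewrite (eq_Ex _ (h2 := fun F => \prod_(v in setT) z ^+ #|Nb (adj F) kappa pi t v|)) //.
  by move=> F; apply: eq_bigl => v; rewrite inE.
have [m] := ubnP #|U|; elim: m => // m IH in U * => mU clU.
have [->|/set0Pn[v0 v0U]] := eqVneq U set0.
  by rewrite cards0 muln0 expr0 (eq_Ex _ (h2 := fun=> 1)) ?Ex_cst // => F; rewrite big_set0.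
(* A vertex of maximal rank in [U] is the parent of no vertex of [U], so its removal leaves a
   parent-closed set. *)
pose v := [arg max_(v > v0 in U) r v].
have [vU vmax] : v \in U /\ forall u, u \in U -> (r u <= r v)%N.
  by rewrite /v; case: arg_maxnP.
pose U' := U :\ v.
have cU := cardsD1 v U; rewrite vU -/U' in cU.
have U'U u : u \in U' -> u \in U by rewrite inE => /andP[].
have pU u w : u \in U -> pi u = Some w -> w \in U'.
  move=> uU puw; have := rP u; rewrite puw => rwu.
  rewrite !inE (clU _ _ uU puw) andbT; apply: contraTneq rwu => ->.
  by rewrite -leqNgt vmax.
have clU' : parent_closed pi U' by move=> u w /U'U; apply: pU.
(* The pairs at [v] come from [G], all others from [F]. *)
rewrite (Ex_mix p (~: star v)).
have Fpart F G u : u \in U' ->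
    forall t, Nb (adj (mix (~: star v) F G)) kappa pi t u = Nb (adj F) kappa pi t u
      /\ Nb (adj F) kappa pi t u \subset U'.
  move=> uU' s; have ab : {in U' &, adj (mix (~: star v) F G) =2 adj F}.
    move=> x y; rewrite !inE => /andP[xv _] /andP[yv _].
    by rewrite /adj in_mix in_setC edge_star (negbTE xv) (negbTE yv).
  by have [<- ?] := Nb_local kappa s clU' ab uU'.
apply: (le_trans (y := Ex p (fun F =>
   (1 - p + p * z) ^+ kappa * \prod_(u in U') z ^+ #|Nb (adj F) kappa pi t u|))); last first.
  rewrite ExZ cU mulnS exprD ler_wpM2l //; first by rewrite exprn_ge0 //; lra.
  by apply: IH => //; lia.
apply: Ex_le => // F.
rewrite (eq_Ex _ (h2 := fun G => (\prod_(u in U') z ^+ #|Nb (adj F) kappa pi t u|) *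
    z ^+ #|Nb (adj (mix (~: star v) F G)) kappa pi t v|)); last first.
  move=> G; rewrite (bigD1 v) //= mulrC; congr (_ * _).
  rewrite (eq_bigl (mem U')); last by move=> u; rewrite !inE andbC.
  by apply: eq_bigr => u uU'; have [->] := Fpart F G u uU' t.
rewrite ExZ mulrC ler_wpM2r //.
  by apply: prodr_ge0 => u _; rewrite exprn_ge0 // (le_trans _ z1).
(* Covers the cases where N(v) is empty by definition: no unrolling left, no parent, or the
   cut-off. *)
have one : Ex p (fun _ : {set 'I_n * 'I_n} => z ^+ 0) <= (1 - p + p * z) ^+ kappa.
  by rewrite Ex_cst expr0 exprn_ege1.
case: t Fpart {IH} => [|t] Fpart.
  by apply: le_trans one; apply: Ex_le => // G; rewrite cards0.
under eq_Ex => G do rewrite NbS.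
case pv : (pi v) => [u|]; last by apply: le_trans one; apply: Ex_le => // G; rewrite cards0.
have uU' := pU _ _ vU pv.
under eq_Ex => G do rewrite (Fpart F G u uU' t).1 /=.
have [Kk|_] := leqP; last by apply: le_trans one; apply: Ex_le => // G; rewrite cards0.
set K := u |: _ in Kk *.
have KU' : K \subset U' by rewrite subUset sub1set uU'; have [] := Fpart F F u uU' t.
rewrite (eq_Ex _ (h2 := fun G => z ^+ #|G :&: [set edge v w | w in K]|)).
  rewrite Ex_exp ler_weXn2l //.
  by apply: leq_trans (leq_imset_card _ _) _.
move=> G; congr (_ ^+ _); rewrite -card_edge_trace; apply: eq_card => w.
rewrite [LHS]in_set [RHS]in_set.
case: (boolP (w \in K)) => //= wK.
have vw : v != w by have := subsetP KU' _ wK; rewrite !inE eq_sym => /andP[].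
by rewrite /adj vw in_mix in_setC edge_star eqxx.
Qed.

End Moment.

End Graph.

(** The product measure lives on all ordered pairs, loops and decreasing pairs included; its trace
    on [edge_pairs n] has the law of G(n,p). *)
Lemma Gnp_probE (R : realType) n (p : R) (A : pred {set 'I_n * 'I_n}) :
  Gnp_prob p A = Pr p (fun F => A (F :&: edge_pairs n)).
Proof.
rewrite /Gnp_prob.
transitivity (Ex p (fun F => \sum_(E : {set 'I_n * 'I_n} | (E \subset edge_pairs n) && A E)
    (F :&: edge_pairs n == E)%:R)).
  rewrite Ex_sum; apply: eq_bigr => E /andP[Ep _].
  by rewrite -(Pr_trace p Ep).
apply: eq_Ex => F; have [AF|AF] := boolP (A _).
  rewrite (bigD1 (F :&: edge_pairs n)) ?subsetIr //= eqxx big1 ?addr0 // => E /andP[_].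
  by rewrite eq_sym => /negbTE ->.
rewrite big1 // => E /andP[_ AE]; case: eqP => // FE.
by rewrite FE AE in AF.
Qed.

(** * Upper tail *)

Section Cliques.
Variable n : nat.
Implicit Types (u v w : 'I_n) (A B K : {set 'I_n}) (F G : {set 'I_n * 'I_n}).

Definition pairs A : {set 'I_n * 'I_n} :=
  [set e in edge_pairs n | (e.1 \in A) && (e.2 \in A)].

Lemma in_pairs A u w : u != w -> (edge u w \in pairs A) = (u \in A) && (w \in A).
Proof.
by move=> uw; rewrite inE edge_pair //= /edge; case: ifP => //= _; rewrite andbC.
Qed.

Lemma cliqueP F A :
  reflect {in A &, forall u w, u != w -> adj F u w} (pairs A \subset F).
Proof.
apply: (iffP subsetP) => [AF u w uA wA uw|AF e].
  by rewrite /adj uw AF // in_pairs // uA.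
rewrite inE => /and3P[ep e1 e2]; have e12 : e.1 != e.2.
  by move: ep; rewrite inE; apply: contraTneq => ->; rewrite ltnn.
by have := AF _ _ e1 e2 e12; rewrite /adj e12 edge_pairE.
Qed.

Lemma pairsI A B : pairs (A :&: B) = pairs A :&: pairs B.
Proof.
apply/setP => e; rewrite !inE; case: (e.1 < e.2)%N => //=.
by case: (e.1 \in A); case: (e.1 \in B); case: (e.2 \in A); rewrite ?andbF.
Qed.

Lemma card_pairs A : #|pairs A| = 'C(#|A|, 2).
Proof.
have [m] := ubnP #|A|; elim: m => // m IH in A * => mA.
have [->|/set0Pn[v vA]] := eqVneq A set0.
  by rewrite cards0 bin0n; apply: eq_card0 => e; rewrite !inE !andbF.
have cA := cardsD1 v A; rewrite vA in cA.
have -> : pairs A = pairs (A :\ v) :|: [set edge v w | w in A :\ v].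
  apply/setP => e; apply/idP/idP; last first.
    rewrite in_setU => /orP[|/imsetP[w]].
      by rewrite !inE => /and3P[-> /andP[_ ->] /andP[_ ->]].
    by rewrite in_setD1 => /andP[wv wA] ->; rewrite in_pairs 1?eq_sym ?vA.
  rewrite inE => /and3P[ep e1 e2]; rewrite in_setU.
  have e12 : e.1 != e.2.
    by move: ep; rewrite inE; apply: contraTneq => ->; rewrite ltnn.
  rewrite -{1}(edge_pairE ep) in_pairs // !in_setD1 e1 e2 !andbT.
  have [e1v|e1v] := eqVneq e.1 v; rewrite /=.
    by apply/imsetP; exists e.2; rewrite -?e1v ?edge_pairE // !inE e2 eq_sym e12.
  have [e2v|//] := eqVneq e.2 v.
  by apply/imsetP; exists e.1; rewrite -?e2v ?[edge e.2 _]edgeC ?edge_pairE // !inE e1 e12.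
rewrite cardsU card_imset; last exact: edge_inj.
rewrite IH; last by lia.
have -> : pairs (A :\ v) :&: [set edge v w | w in A :\ v] = set0.
  apply/setP => e; rewrite [RHS]inE in_setI; apply/negP => /andP[h /imsetP[w wA ew]].
  move: wA h; rewrite ew in_setD1 => /andP[wv _].
  by rewrite in_pairs 1?eq_sym // !inE eqxx.
by rewrite cards0 subn0 cA /= add1n binS bin1.
Qed.

Variables (R : realType) (p : R).
Hypothesis p01 : 0 <= p <= 1.

Lemma Pr_clique A : Pr p (fun F => pairs A \subset F) = p ^+ 'C(#|A|, 2).
Proof. by rewrite Pr_sub card_pairs. Qed.

Lemma Pr_clique_exists k :
  Pr p (fun F => [exists K : {set 'I_n}, (#|K| == k) && (pairs K \subset F)])
    <= ('C(n, k))%:R * p ^+ 'C(k, 2).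
Proof.
apply: le_trans (Pr_exists p01 _ _) _.
rewrite (eq_bigr (fun=> p ^+ 'C(k, 2))) => [|K /eqP Kk]; last by rewrite Pr_clique Kk.
by rewrite sumr_const -[in 'C(n, _)](card_ord n) -card_draws cardsE mulr_natl.
Qed.

Lemma clique_le_of_no_clique F kappa :
  ~~ [exists K : {set 'I_n}, (#|K| == kappa.+1) && (pairs K \subset F)] ->
  forall K : {set 'I_n}, {in K &, forall u w, u != w -> adj F u w} -> (#|K| <= kappa)%N.
Proof.
move=> noK K clK; rewrite leqNgt; apply: contra noK => /card_geqP[s [us ss sK]].
apply/existsP; exists [set x in s].
rewrite cardsE (card_uniqP us) ss eqxx; apply/cliqueP => u w.
by rewrite !inE => /sK uK /sK wK; apply: clK.
Qed.

(** Either a clique of size [kappa.+1] exists, bounded by the first moment, or [chordal_card_le]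
    applies. Then Markov's inequality for z to the sum of |N(v)| is combined with a union bound over
    the at most (n+1)^n parent functions. *)
Lemma max_chordal_upper_tail kappa m (z : R) : 1 <= z ->
  Pr p (fun F => (m < max_chordal (F :&: edge_pairs n))%N) <=
    ('C(n, kappa.+1))%:R * p ^+ 'C(kappa.+1, 2) +
    n.+1%:R ^+ n * (1 - p + p * z) ^+ (kappa * n) / z ^+ m.
Proof.
move=> z1; have zm : 0 < z ^+ m by rewrite exprn_gt0 // (lt_le_trans ltr01).
pose NN F (pi : {ffun 'I_n -> option 'I_n}) := \prod_v z ^+ #|Nb (adj F) kappa pi n v|.
apply: le_trans (Pr_le_or p01
   (A1 := fun F => [exists K : {set 'I_n}, (#|K| == kappa.+1) && (pairs K \subset F)])
   (A2 := fun F => [exists pi : {ffun 'I_n -> option 'I_n},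
              acyclic pi && (z ^+ m <= NN F pi)]) _) _.
  move=> F mF; case: (boolP [exists K, _]) => [//|/clique_le_of_no_clique noK /=].
  have /existsP[H /and3P[HE cH mH]] :
     [exists H : {set 'I_n * 'I_n}, [&& H \subset F :&: edge_pairs n, chordal H & (m < #|H|)%N]].
    apply: contraLR mF => /existsPn nH.
    rewrite -leqNgt /max_chordal; apply/bigmax_leqP => H /andP[HE cH].
    by have := nH H; rewrite HE cH -leqNgt.
  have [pi api Hpi] := chordal_card_le HE cH noK.
  apply/existsP; exists pi; rewrite api /NN prodrXr ler_weXn2l //.
  by apply: leq_trans Hpi; apply: ltnW.
apply: lerD; first exact: Pr_clique_exists.
apply: le_trans (Pr_exists p01 _ _) _.
apply: le_trans (ler_sum (G := fun=> (1 - p + p * z) ^+ (kappa * n) / z ^+ m) _ _) _.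
  move=> pi api; apply: le_trans (markov p01 _ zm) _.
    by move=> F; apply: prodr_ge0 => v _; rewrite exprn_ge0 // (le_trans _ z1).
  by rewrite ler_pM2r ?invr_gt0 //; apply: Nb_moment.
rewrite sumr_const -[X in X <= _]mulr_natl -mulrA ler_wpM2r //.
  have /andP[p0 p1] := p01; rewrite mulr_ge0 ?invr_ge0 ?(ltW zm) // exprn_ge0 //.
  by rewrite addr_ge0 ?subr_ge0 ?mulr_ge0 ?(le_trans _ z1).
rewrite -natrX ler_nat; apply: leq_trans (max_card _) _.
by rewrite card_ffun card_option card_ord.
Qed.

End Cliques.

(** * Attaching vertices to disjoint cliques *)

Lemma binomial_prob_itv (R : realType) (p : R) (k d : nat) : 0 <= p <= 1 ->
  0 <= ('C(k, d))%:R * p ^+ d * (1 - p) ^+ (k - d) <= 1.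
Proof.
move=> p01; have := Pr_card p (setT : {set 'I_k}) d; rewrite cardsT card_ord => <-.
rewrite Pr_ge0 //= -[X in _ <= X](Ex_cst 'I_k p); apply: Ex_le => // F.
by case: eqP.
Qed.

Section Attach.
Variable n : nat.
Implicit Types (u v w : 'I_n) (A K W : {set 'I_n}) (F G H : {set 'I_n * 'I_n}).
Implicit Types (D : {set {set 'I_n}}).

(** The successor and predecessor on the cycle are nonadjacent because its length exceeds 3. The
    conclusion, free of cyclic indices, is all that is needed to refute holes in the constructed
    graph. *)
Lemma induced_cycle_core H : has_induced_cycle H ->
  exists2 X : {set 'I_n}, X != set0 & {in X, forall x, exists y, exists z,
    [/\ y \in X, z \in X, y != z & [/\ adjb H x y, adjb H x z & ~~ adjb H y z]]}.
Proof.
move=> /existsP[k /existsP[f /and3P[k3 /injectiveP fi /forallP fc]]].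
have {}fc i j : adjb H (f i) (f j) = cyc_adj i j.
  by have /forallP/(_ j)/eqP := fc i.
exists [set f i | i : 'I_k].
  by apply/set0Pn; exists (f (Ordinal (ltnW (ltnW (ltnW k3))))); apply: imset_f.
move=> _ /imsetP[i _ ->].
have sk : ((if i.+1 == k then 0 else i.+1) < k)%N by have := ltn_ord i; case: eqP; lia.
have pk : ((if i == 0%N :> nat then k.-1 else i.-1) < k)%N by have := ltn_ord i; case: eqP; lia.
have wrap l : (l < k)%N -> (l.+1 %% k = if l.+1 == k then 0 else l.+1)%N.
  move=> lk; case: eqP => [->|h]; first by rewrite modnn.
  by rewrite modn_small //; lia.
exists (f (Ordinal sk)), (f (Ordinal pk)); rewrite !fc !imset_f //.
rewrite (inj_eq fi) -val_eqE /cyc_adj /= !wrap //.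
move: (nat_of_ord i) (ltn_ord i) => m mk {sk pk fc fi wrap}.
move: (nat_of_ord k) k3 mk => l l3 ml.
have [e1|e1] := eqVneq m.+1 l; have [e2|e2] := eqVneq m 0%N; split=> //; try split;
  do ?[case: ifP => ?]; lia.
Qed.

Definition unattached W D (d : nat) F : {set 'I_n} :=
  [set v | (v \notin W) && [forall K in D, (#|[set w in K | edge v w \in F]| < d)%N]].

(** The subgraph consists of the disjoint cliques in [D], plus the edges from each attached vertex
    to its neighbours in one chosen clique; every attached vertex brings at least [d] edges. *)
Lemma max_chordal_ge_attach F W D d : trivIset D ->
  {in D, forall K, K \subset W /\ pairs K \subset F} ->
  ((n - #|W| - #|unattached W D d F|) * d <= max_chordal (F :&: edge_pairs n))%N.
Proof.
move=> /trivIsetP triv DP.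
pose N v K := [set w in K | edge v w \in F].
pose att v := if v \in W then set0 else
  if [pick K in D | (d <= #|N v K|)%N] is Some K then N v K else set0.
have attP v w : w \in att v -> [/\ v \notin W, w \in W, edge v w \in F &
    exists2 K, K \in D & att v \subset K].
  rewrite /att; case: ifP => [_|vV]; first by rewrite inE.
  case: pickP => [K /andP[KD _]|_]; last by rewrite inE.
  rewrite inE => /andP[wK wF]; split => //; first by rewrite (subsetP (DP _ KD).1).
  by exists K => //; apply/subsetP => x; rewrite inE => /andP[].
pose same u w := [exists K in D, (u \in K) && (w \in K)].
have same_sym u w : same u w = same w u.
  by apply: eq_existsb => K; rewrite [(u \in K) && _]andbC.
have sameV u w : same u w -> u \in W.
  by move=> /exists_inP[K KD /andP[uK _]]; rewrite (subsetP (DP _ KD).1).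
pose H := [set e in edge_pairs n |
  [|| same e.1 e.2, e.1 \in att e.2 | e.2 \in att e.1]].
have Hp : H \subset edge_pairs n by apply/subsetP => e; rewrite inE => /andP[].
have inH u w : u != w -> (edge u w \in H) = [|| same u w, u \in att w | w \in att u].
  move=> uw; rewrite in_set edge_pair //= /edge; case: ifP => //= _.
  by rewrite same_sym; congr orb; rewrite orbC.
have cH : chordal H.
  apply/negP => /induced_cycle_core[X /set0Pn[x0 x0X] XP].
  have adjH u w : adjb H u w = (u != w) && [|| same u w, u \in att w | w \in att u].
    rewrite adjb_edge //; have [//|uw] := eqVneq u w; exact: inH.
  (* All neighbours in [H] of a vertex outside [W] lie in one clique, so such a vertex has no two
     nonadjacent neighbours. *)
  have [/exists_inP[x xX xV]|nV] := boolP [exists x in X, x \notin W].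
    have xatt y : adjb H x y -> y \in att x.
      rewrite adjH => /andP[_ /or3P[/sameV|/attP[_]|//]]; by rewrite (negbTE xV).
    have [y [z [_ _ yz [xy xz]]]] := XP _ xX; rewrite adjH yz /= => /negP; apply.
    have [_ _ _ [K KD aK]] := attP _ _ (xatt _ xy).
    apply/or3P; apply: Or31; apply/exists_inP; exists K => //.
    by rewrite !(subsetP aK) ?xatt.
  (* The core thus lies inside [W], where [H] is a disjoint union of cliques. *)
  have XV x : x \in X -> x \in W.
    by move=> xX; apply: contraNT nV => xV; apply/exists_inP; exists x.
  have xsame x y : x \in X -> y \in X -> adjb H x y -> same x y.
    move=> /XV xV /XV yV; rewrite adjH => /andP[_ /or3P[//|/attP[]|/attP[]]].
      by rewrite yV.
    by rewrite xV.
  have [y [z [yX zX yz [xy xz]]]] := XP _ x0X; rewrite adjH yz /= => /negP; apply.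
  have /exists_inP[K KD /andP[xK yK]] := xsame _ _ x0X yX xy.
  have /exists_inP[L LD /andP[xL zL]] := xsame _ _ x0X zX xz.
  have KL : K = L.
    apply/eqP; apply: contraT => KL; have /pred0P/(_ x0) := triv _ _ KD LD KL.
    by rewrite /= xK xL.
  by apply/or3P; apply: Or31; apply/exists_inP; exists K; rewrite // yK KL.
have HF : H \subset F.
  apply/subsetP => e; rewrite inE => /andP[ep].
  have e12 : e.1 != e.2.
    by move: ep; rewrite inE; apply: contraTneq => ->; rewrite ltnn.
  move=> /or3P[/exists_inP[K KD eK]|/attP[_ _ + _]|/attP[_ _ + _]].
  - by rewrite -(edge_pairE ep) (subsetP (DP _ KD).2) // in_pairs.
  - by rewrite edgeC edge_pairE.
  by rewrite edge_pairE.
have : (#|H| <= max_chordal (F :&: edge_pairs n))%N.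
  apply: (@leq_bigmax_cond _ (fun H => (H \subset _) && chordal H) (fun H => #|H|)).
  by rewrite subsetI HF Hp cH.
apply: leq_trans.
(* Only the edges leaving [W] are counted; those inside the cliques are given up. *)
pose P := [set x : 'I_n * 'I_n | x.2 \in att x.1].
have PH : [set edge x.1 x.2 | x in P] \subset H.
  apply/subsetP => _ /imsetP[[v w] + ->] /=; rewrite inE /= => vw.
  have [vV wV _ _] := attP _ _ vw.
  by rewrite inH ?vw ?orbT //; apply: contraNneq vV => ->.
apply: leq_trans (subset_leq_card PH); rewrite card_in_imset; last first.
  move=> [v w] [v' w']; rewrite !inE /= => /attP[vV wV _ _] /attP[vV' wV' _ _].
  rewrite /edge; case: ifP => _; case: ifP => _ [] e1 e2; subst => //.
    by rewrite wV' in vV.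
  by rewrite wV in vV'.
have -> : #|P| = (\sum_v #|att v|)%N.
  rewrite -sum1_card (eq_bigl (fun x => xpredT x.1 && (x.2 \in att x.1))); last first.
    by move=> x; rewrite inE.
  rewrite -(pair_big_dep xpredT (fun v u => u \in att v) (fun _ _ => 1%N)) /=.
  by apply: eq_bigr => v _; rewrite sum1_card.
pose U := unattached W D d F.
have -> : (n - #|W| - #|U| = #|~: W :\: U|)%N.
  have UV : U \subset ~: W by apply/subsetP => v; rewrite !inE => /andP[].
  by rewrite cardsD (setIidPr UV) [#|~: W|]cardsCs setCK card_ord.
rewrite -sum_nat_const [X in (X <= _)%N]big_mkcond; apply: leq_sum => v _.
case: ifP => // ; rewrite !inE => /andP[+ vV]; rewrite vV /= => /forall_inPn[K KD dK].
rewrite /att (negbTE vV); case: pickP => [L /andP[_]//|/(_ K)].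
by rewrite KD /= leqNgt /N dK.
Qed.

Variables (R : realType) (p : R).
Hypothesis p01 : 0 <= p <= 1.

(** For a fixed vertex the cliques of [D] give disjoint blocks of pairs, so its failures at them are
    independent. *)
Lemma card_unattached_mean W D (d k : nat) : trivIset D ->
  {in D, forall K, #|K| = k} ->
  Ex p (fun F => #|unattached W D d F|%:R)
   <= n%:R * (1 - ('C(k, d))%:R * p ^+ d * (1 - p) ^+ (k - d)) ^+ #|D|.
Proof.
move=> /trivIsetP triv Dk; set c := 1 - _.
(* Having fewer than [d] neighbours excludes having exactly [d]; a single term of the binomial tail
   is enough. *)
have PrB v K : K \in D ->
    Pr p (fun F => (#|F :&: [set edge v w | w in K]| < d)%N) <= c.
  move=> KD; have := Pr_card p [set edge v w | w in K] d.
  rewrite card_imset; last exact: edge_inj.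
  rewrite Dk // /c => <-; rewrite -Pr_compl //; apply: Pr_le => // F.
  by case: eqP => // ->; rewrite ltnn.
have [->|/set0Pn[K0 K0D]] := eqVneq D set0.
  rewrite cards0 expr0 mulr1 -[X in _ <= X](Ex_cst ('I_n * 'I_n)%type p); apply: Ex_le => // F.
  by rewrite ler_nat; apply: leq_trans (max_card _) _; rewrite card_ord.
have [n0|n0] := posnP n.
  rewrite [X in X%:R * _]n0 mul0r -[X in _ <= X](Ex_cst ('I_n * 'I_n)%type p).
  by apply: Ex_le => // F; rewrite lern0 -leqn0; apply: leq_trans (max_card _) _; rewrite card_ord n0.
have c0 : 0 <= c.
  by apply: (le_trans _ (PrB (Ordinal n0) _ K0D)); apply: Pr_ge0.
rewrite (eq_Ex _ (h2 := fun F => \sum_(v in 'I_n) (v \in unattached W D d F)%:R)); last first.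
  move=> F; rewrite -natr_sum -sum1_card big_mkcond; congr (_%:R);
  by apply: eq_bigr => v _; case: ifP.
rewrite Ex_sum; apply: le_trans (ler_sum (G := fun=> c ^+ #|D|) _ _) _; last first.
  by rewrite sumr_const card_ord mulr_natl.
move=> v _; rewrite cardE.
apply: (le_trans (y :=
  Pr p (fun F => all (fun K => (#|F :&: [set edge v w | w in K]| < d)%N) (enum D)))).
  apply: Pr_le => // F; rewrite inE => /andP[_ /forall_inP h].
  by apply/allP => K; rewrite mem_enum => /h; rewrite card_edge_trace.
apply: (Pr_all_blocks p01 (B := fun K => [set edge v w | w in K])
  (A := fun K F => (#|F :&: [set edge v w | w in K]| < d)%N)) => //.
- exact: enum_uniq.
- move=> K L; rewrite !mem_enum => KD LD KL; rewrite -setI_eq0.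
  apply/eqP/setP => e; rewrite [RHS]inE in_setI; apply/negP.
  move=> /andP[/imsetP[w wK ->] /imsetP[w' wL]].
  move/edge_inj => ww; have /pred0P/(_ w) := triv _ _ KD LD KL.
  by rewrite /= wK ww wL.
- by move=> K _ F G ->.
by move=> K; rewrite mem_enum; apply: PrB.
Qed.

Definition clique_family W (k M : nat) F D :=
  [&& trivIset D, (M <= #|D|)%N &
      [forall K in D, [&& K \subset W, #|K| == k & pairs K \subset F]]].

(** Exposure in two rounds: the pairs inside [W] determine a clique family, and the remaining pairs
    are still independent of it when the other vertices are attached. Markov's inequality then
    bounds the probability of more than [b] unattached vertices. *)
Lemma max_chordal_lower_tail W (k M d b : nat) :
  Pr p (fun F => (max_chordal (F :&: edge_pairs n) < (n - #|W| - b) * d)%N) <=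
    Pr p (fun F => ~~ [exists D, clique_family W k M F D]) +
    n%:R * (1 - ('C(k, d))%:R * p ^+ d * (1 - p) ^+ (k - d)) ^+ M / b.+1%:R.
Proof.
set c := 1 - _.
have c01 : 0 <= c <= 1 by have := binomial_prob_itv k d p01; rewrite /c; lra.
rewrite [X in X <= _](Ex_mix p (pairs W)).
rewrite -[X in _ + X](Ex_cst ('I_n * 'I_n)%type p) -ExD; apply: Ex_le => // F.
have b0 : 0 < b.+1%:R :> R by rewrite ltr0n.
have r0 : 0 <= n%:R * c ^+ M / b.+1%:R.
  by rewrite divr_ge0 ?mulr_ge0 ?exprn_ge0 //; case/andP: c01.
have [/existsP[D /and3P[tD MD /forall_inP DP]]|_] :=
  boolP [exists D, clique_family W k M F D]; last first.
  rewrite -[X in X <= _]addr0; apply: lerD => //.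
  rewrite -[X in _ <= X](Ex_cst ('I_n * 'I_n)%type p); apply: Ex_le => // G.
  by case: (_ < _)%N.
rewrite add0r.
have Vp K : K \subset W -> pairs K \subset pairs W.
  move=> /subsetP KV; apply/subsetP => e; rewrite !inE => /and3P[-> e1 e2].
  by rewrite !KV.
apply: (le_trans (y := Pr p (fun G => b.+1%:R <= #|unattached W D d G|%:R :> R))).
  apply: Pr_le => // G; rewrite ler_nat; apply: contraLR; rewrite -!leqNgt => hb.
  have := @max_chordal_ge_attach (mix (pairs W) F G) W D d tD.
  (* Whether a vertex outside [W] is attached depends only on pairs not inside [W], which come from
     [G]. *)
  have -> : unattached W D d (mix (pairs W) F G) = unattached W D d G.
    apply/setP => v; rewrite [LHS]in_set [RHS]in_set; case: (boolP (v \in W)) => //= vV.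
    apply: eq_forallb => K; case: (boolP (K \in D)) => //= KD; congr (_ < _)%N.
    apply: eq_card => w; rewrite [LHS]in_set [RHS]in_set; case: (boolP (w \in K)) => //= wK.
    have /and3P[/subsetP KV _ _] := DP _ KD.
    have vw : v != w by apply: contraNneq vV => ->; apply: KV.
    by rewrite in_mix in_pairs // (negbTE vV).
  move=> h; apply: leq_trans (h _).
    by rewrite leq_mul2r leq_sub2l ?orbT.
  move=> K KD; have /and3P[KV _ KF] := DP _ KD; split => //.
  apply/subsetP => e eK; rewrite in_mix (subsetP (Vp _ KV)) //.
  by rewrite (subsetP KF).
apply: le_trans (markov p01 _ b0) _; first by move=> G; rewrite ler0n.
rewrite ler_pM2r ?invr_gt0 //.
apply: le_trans (card_unattached_mean W d tD _) _.
  by move=> K KD; have /and3P[_ /eqP -> _] := DP _ KD.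
by rewrite -/c ler_wpM2l // ler_wiXn2l //; case/andP: c01.
Qed.

End Attach.

(** * Many disjoint cliques *)

(** Ordered pairs, the diagonal included: a nonempty member meets itself. *)
Definition meeting (T : finType) (C : {set {set T}}) : {set {set T} * {set T}} :=
  [set x | [&& x.1 \in C, x.2 \in C & x.1 :&: x.2 != set0]].

(* Discard the members meeting more than twice the average number of members;
   at least half of [C] survives, and a maximal disjoint family of survivors
   meets all of them. *)
Lemma large_disjoint_subfamily (T : finType) (C : {set {set T}}) :
  set0 \notin C -> exists D : {set {set T}}, [/\ D \subset C, trivIset D &
    (#|C| ^ 2 <= 4 * #|D| * #|meeting C|)%N].
Proof.
move=> C0; pose nb A := [set B in C | A :&: B != set0].
have self A : A \in C -> A \in nb A.
  by move=> CA; rewrite inE CA setIid; apply: contraNneq C0 => <-.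
set Q := #|meeting C|.
have QE : Q = (\sum_(A in C) #|nb A|)%N.
  rewrite /Q -sum1_card (eq_bigl (fun x => (x.1 \in C) && (x.2 \in nb x.1))); last first.
    by move=> x; rewrite !inE.
  rewrite -(pair_big_dep (mem C) (fun A B => B \in nb A) (fun _ _ => 1%N)) /=.
  by apply: eq_bigr => A _; rewrite sum1_card.
pose good := [set A in C | (#|nb A| * #|C| <= 2 * Q)%N].
have hgood : (#|C| <= 2 * #|good|)%N.
  have [->|/set0Pn[A0 A0C]] := eqVneq C set0; first by rewrite cards0.
  have Q0 : (0 < Q)%N.
    rewrite QE (bigD1 A0) //= addn_gt0 card_gt0; apply/orP; left.
    by apply/set0Pn; exists A0; apply: self.
  have : (#|C :\: good| * (2 * Q) <= Q * #|C|)%N.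
    rewrite -sum_nat_const QE [X in (_ <= X * _)%N](bigID (mem good)) /= mulnDl.
    apply: leq_trans (leq_addl _ _); rewrite big_distrl /=.
    rewrite [X in (_ <= X)%N](eq_bigl (mem (C :\: good))); last first.
      by move=> A; rewrite [RHS]in_setD andbC.
    apply: leq_sum => A; rewrite -QE in_setD in_set => /andP[+ CA].
    by rewrite CA /= -ltnNge => /ltnW.
  rewrite mulnA [X in (_ <= X)%N]mulnC leq_pmul2r //.
  have gC : good \subset C by apply/subsetP => A; rewrite inE => /andP[].
  rewrite cardsD (setIidPr gC).
  have := subset_leq_card gC; lia.
have : exists D : {set {set T}}, (D \subset good) && trivIset D.
  by exists set0; rewrite sub0set /=; apply/trivIsetP => A B; rewrite inE.
move=> [D0 D0P]; have [D /maxsetP[/andP[Dg tD] Dmax] _] 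
  := @maxset_exists _ (fun D => (D \subset good) && trivIset D) D0 D0P.
exists D; split => //.
  by apply: subset_trans Dg _; apply/subsetP => A; rewrite inE => /andP[].
have gC A : A \in good -> A \in C by rewrite inE => /andP[].
have cover_good : good \subset \bigcup_(B in D) nb B.
  apply/subsetP => A Ag; apply/bigcupP.
  have [/exists_inP[B BD AB]|nB] := boolP [exists B in D, B :&: A != set0].
    by exists B => //; rewrite inE gC.
  have disA B : B \in D -> B :&: A = set0.
    by move=> BD; apply/eqP; apply: contraNT nB => h; apply/exists_inP; exists B.
  have AD : A \notin D.
    by apply/negP => /disA; rewrite setIid => A0; rewrite -A0 gC in C0.
  have e : A |: D = D.
    apply: Dmax; last by apply: subsetUr.
    rewrite subUset sub1set Ag Dg /=; apply/trivIsetP => B B'.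
    rewrite !in_setU1 -setI_eq0 => /orP[/eqP ->|BD] /orP[/eqP ->|B'D].
    - by rewrite eqxx.
    - by rewrite setIC disA.
    - by rewrite disA.
    by move=> BB; rewrite setI_eq0; apply: (trivIsetP tD).
  by rewrite -e setU11 in AD.
have h1 : (#|good| <= \sum_(B in D) #|nb B|)%N.
  apply: leq_trans (subset_leq_card cover_good) _.
  elim/big_ind2: _ => // [|m A m' B hA hB]; first by rewrite cards0.
  by apply: leq_trans (leq_add hA hB); apply: leq_of_leqif (leq_card_setU _ _).
have h2 : ((\sum_(B in D) #|nb B|) * #|C| <= #|D| * (2 * Q))%N.
  rewrite big_distrl -sum_nat_const /=; apply: leq_sum => B /(subsetP Dg).
  by rewrite inE => /andP[].
nia.
Qed.

(** A division-free form of the bound (k/|W|)^|I| on the proportion of [k]-subsets containing [I]: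
    each further prescribed element costs a factor (k-i)/(|W|-i), at most k/|W|. *)
Lemma card_supersets_le (T : finType) (W I : {set T}) (k : nat) :
  I \subset W -> (k <= #|W|)%N ->
  (#|[set B : {set T} | [&& B \subset W, #|B| == k & I \subset B]]| * #|W| ^ #|I|
    <= k ^ #|I| * 'C(#|W|, k))%N.
Proof.
move=> IW kW.
have [ik|ki] := leqP #|I| k; last first.
  rewrite (_ : [set B | _] = set0) ?cards0 //; apply/setP => B; rewrite !inE.
  apply/negP => /and3P[_ /eqP Bk /subset_leq_card]; lia.
have h1 : (#|[set B : {set T} | [&& B \subset W, #|B| == k & I \subset B]]|
    <= 'C(#|W| - #|I|, k - #|I|))%N.
  have <- : #|W :\: I| = (#|W| - #|I|)%N by rewrite cardsD (setIidPr IW).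
  rewrite -cards_draws -(card_in_imset (f := fun B => B :\: I)); last first.
    move=> B B'; rewrite !inE => /and3P[_ _ IB] /and3P[_ _ IB'] e.
    by rewrite -(setID B I) -(setID B' I) e (setIidPr IB) (setIidPr IB').
  apply/subset_leq_card/subsetP => _ /imsetP[B + ->].
  rewrite !inE => /and3P[BW /eqP Bk IB].
  by rewrite setSD // cardsD (setIidPr IB) Bk eqxx.
apply: leq_trans (leq_mul h1 (leqnn _)) _.
elim: #|I| ik {h1} => [|i IH] ik; first by rewrite !subn0 !expn0 muln1 mul1n.
have {}IH := IH (ltnW ik).
apply: leq_trans (_ : k * (k ^ i * 'C(#|W|, k)) <= _)%N; last by rewrite expnS mulnA.
apply: leq_trans (leq_mul (leqnn k) IH).
rewrite expnS mulnA [in X in (_ <= X)%N]mulnA leq_mul2r; apply/orP; right.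
have := mul_bin_diag (#|W| - i) (k - i.+1).
have -> : (#|W| - i).-1 = (#|W| - i.+1)%N by lia.
have -> : (k - i.+1).+1 = (k - i)%N by lia.
move: 'C(#|W| - i, _) => z.
move: 'C(#|W| - i.+1, _) => y e.
have Wi : (0 < #|W| - i)%N by lia.
have yz : (y <= z)%N by rewrite -(leq_pmul2l Wi) e leq_mul2r; apply/orP; right; lia.
rewrite -[X in (_ * X <= _)%N](subnK (_ : i <= #|W|)%N); last by lia.
rewrite -[X in (_ <= X * _)%N](subnK (ltnW ik)) mulnDr mulnDl [(y * _)%N]mulnC e.
by rewrite leq_add2l mulnC leq_mul2l yz orbT.
Qed.

Lemma half_lt_of_close (R : realFieldType) (a z : R) :
  0 < a -> (z - a) ^+ 2 < a ^+ 2 / 4 -> a ^+ 2 / 4 < z ^+ 2.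
Proof.
move=> a0 h; have hz : a / 2 < z.
  rewrite ltNge; apply/negP => hz.
  have : 0 <= (a / 2 - z) * (a / 2 - z + a) by apply: mulr_ge0; lra.
  by move: h; rewrite !expr2; lra.
have : 0 < (z - a / 2) * (z + a / 2) by apply: mulr_gt0; lra.
by rewrite !expr2; lra.
Qed.

(** * First and second moments of the number of cliques of size k inside W *)

Section SecondMoment.
Variables (n : nat) (R : realType) (p : R) (W : {set 'I_n}) (k : nat).
Hypothesis p01 : 0 < p <= 1.
Hypothesis kW : (0 < k <= #|W|)%N.
Implicit Types (A I : {set 'I_n}) (F : {set 'I_n * 'I_n}).

Let p01' : 0 <= p <= 1. Proof. by have /andP[/ltW -> ->] := p01. Qed.

Definition ksubsets : {set {set 'I_n}} :=
  [set A : {set 'I_n} | A \subset W & #|A| == k].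
Definition kcliques F := [set A in ksubsets | pairs A \subset F].

Let mu : R := ('C(#|W|, k))%:R * p ^+ 'C(k, 2).
(** The mean size of the intersection of two independent uniform [k]-subsets of [W]. *)
Let x : R := k%:R ^+ 2 / #|W|%:R.

Lemma kcliquesE F : #|kcliques F|%:R = \sum_(A in ksubsets) (pairs A \subset F)%:R :> R.
Proof.
rewrite -sum1_card natr_sum big_mkcond [RHS]big_mkcond; apply: eq_bigr => A _.
by rewrite in_set; case: (A \in ksubsets) => //=; case: ifP.
Qed.

Lemma Ex_kcliques : Ex p (fun F => #|kcliques F|%:R) = mu.
Proof.
rewrite (eq_Ex _ kcliquesE) Ex_sum (eq_bigr (fun=> p ^+ 'C(k, 2))); last first.
  move=> A; rewrite inE => /andP[_ /eqP Ak].
  by rewrite -[LHS]/(Pr p (fun F => pairs A \subset F)) Pr_clique Ak.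
by rewrite sumr_const cards_draws /mu mulr_natl.
Qed.

Definition pair_prob A A' : R := p ^+ #|pairs A :|: pairs A'|.

Lemma pair_probE A A' : pair_prob A A' =
  Ex p (fun F => (pairs A \subset F)%:R * (pairs A' \subset F)%:R).
Proof.
rewrite /pair_prob -Pr_sub; apply: eq_Ex => F.
by rewrite subUset -natrM mulnb.
Qed.

Lemma Ex_meeting : Ex p (fun F => #|meeting (kcliques F)|%:R) =
  \sum_(A in ksubsets) \sum_(A' in ksubsets | A :&: A' != set0) pair_prob A A'.
Proof.
under [RHS]eq_bigr => A _ do under eq_bigr => A' _ do rewrite pair_probE.
under [RHS]eq_bigr => A _ do rewrite -Ex_sum.
rewrite -Ex_sum; apply: eq_Ex => F.
rewrite pair_big_dep /= -sum1_card natr_sum [LHS]big_mkcond [RHS]big_mkcond /=.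
apply: eq_bigr => -[A A'] _ /=; rewrite [_ \in meeting _]in_set /= ![_ \in kcliques F]in_set.
case: (A \in ksubsets); case: (A' \in ksubsets); rewrite /= ?andbF //.
case: (A :&: A' != set0); case: (pairs A \subset F); case: (pairs A' \subset F);
  by rewrite /= ?(mulr0, mul0r, mulr1).
Qed.

Lemma pair_prob_overlap A A' : A \in ksubsets -> A' \in ksubsets ->
  pair_prob A A' = p ^+ (2 * 'C(k, 2)) * p^-1 ^+ 'C(#|A :&: A'|, 2).
Proof.
have /andP[p0 p1] := p01.
rewrite !inE => /andP[_ /eqP Ak] /andP[_ /eqP A'k].
rewrite /pair_prob cardsU -pairsI !card_pairs Ak A'k.
have h : ('C(#|A :&: A'|, 2) <= 'C(k, 2))%N.
  by apply: leq_bin2l; rewrite -Ak subset_leq_card ?subsetIl.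
rewrite exprVn; apply: (canRL (mulfK _)); first by rewrite expf_neq0 // gt_eqF.
by rewrite -exprD subnK ?addnn ?mul2n //; lia.
Qed.

(** Disjoint pairs of [k]-sets are independent and contribute at most the squared mean; all others
    are counted by [meeting]. *)
Lemma Ex_kcliques_sqr :
  Ex p (fun F => #|kcliques F|%:R ^+ 2) <= mu ^+ 2 + Ex p (fun F => #|meeting (kcliques F)|%:R).
Proof.
have /andP[p0 p1] := p01.
rewrite Ex_meeting (eq_Ex _ (h2 := fun F => \sum_(A in ksubsets) \sum_(A' in ksubsets)
    (pairs A \subset F)%:R * (pairs A' \subset F)%:R)); last first.
  move=> F; rewrite kcliquesE expr2 mulr_suml; apply: eq_bigr => A _.
  by rewrite mulr_sumr.
rewrite Ex_sum; under eq_bigr => A _ do rewrite Ex_sum.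
under eq_bigr => A _ do under eq_bigr => A' _ do rewrite -pair_probE.
under eq_bigr => A _ do rewrite (bigID (fun A' => A :&: A' != set0)) /=.
rewrite big_split /= addrC lerD2r.
apply: (le_trans (y := \sum_(A in ksubsets) \sum_(A' in ksubsets) p ^+ (2 * 'C(k, 2)))).
  apply: ler_sum => A AK; rewrite [X in _ <= X](bigID (fun A' => A :&: A' != set0)) /=.
  rewrite -[X in X <= _]add0r; apply: lerD.
    by apply: sumr_ge0 => A' _; rewrite exprn_ge0 // ltW.
  apply: ler_sum => A' /andP[A'K /negPn/eqP AA'].
  by rewrite pair_prob_overlap // AA' cards0 mulr1.
rewrite !sumr_const !cards_draws /mu exprMn -exprM [('C(k, 2) * 2)%N]mulnC.
by rewrite expr2 -mulrA !mulr_natl.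
Qed.

Lemma sum_subsets_card (A : {set 'I_n}) (g : nat -> R) : #|A| = k ->
  \sum_(I : {set 'I_n} | (I \subset A) && (I != set0)) g #|I| =
  \sum_(i < k) ('C(k, i.+1))%:R * g i.+1.
Proof.
have [j ->] : exists j, k = j.+1 by exists k.-1; have /andP[] := kW; lia.
move=> Ak; rewrite (partition_big (fun I => inord #|I|.-1 : 'I_j.+1) predT) //=.
apply: eq_bigr => i _.
rewrite (eq_bigl (fun I => (I \subset A) && (#|I| == i.+1))); last first.
  move=> I; case: (boolP (I \subset A)) => //= IA.
  have Ik := subset_leq_card IA; rewrite Ak in Ik.
  rewrite -cards_eq0 -val_eqE /=; case: #|I| Ik => [|l] Ik //=.
  by rewrite inordK.
rewrite (eq_bigr (fun=> g i.+1)); last by move=> I /andP[_ /eqP ->].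
by have := cards_draws A i.+1; rewrite Ak sumr_const mulr_natl cardsE => ->.
Qed.

(** The sets [A'] are grouped by I = A ∩ A' and overcounted by all those containing I. The bound
    [b], of order p^(-k/2), turns the sum over |I| into a geometric series of ratio at most 1/2. *)
Lemma Ex_meeting_le (b : R) : 0 <= b -> x * b <= 2^-1 ->
  (forall i, (i < k)%N -> p^-1 ^+ 'C(i.+1, 2) <= b ^+ i) ->
  Ex p (fun F => #|meeting (kcliques F)|%:R) <= 2 * x * mu ^+ 2.
Proof.
move=> b0 xb hb; have /andP[p0 p1] := p01; have /andP[k0 kW'] := kW.
have W0 : 0 < #|W|%:R :> R by rewrite ltr0n; lia.
have x0 : 0 <= x by rewrite /x divr_ge0 ?exprn_ge0 // ltW.
rewrite Ex_meeting.
pose c := p ^+ (2 * 'C(k, 2)).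
have c0 : 0 <= c by rewrite exprn_ge0 // ltW.
apply: (le_trans (y := \sum_(A in ksubsets) c * (('C(#|W|, k))%:R * (2 * x)))); last first.
  rewrite sumr_const cards_draws -mulr_natl /mu exprMn -exprM [('C(k, 2) * 2)%N]mulnC -/c.
  by rewrite le_eqVlt; apply/orP; left; apply/eqP; ring.
apply: ler_sum => A AK; have := AK; rewrite inE => /andP[AW /eqP Ak].
pose g i : R := p^-1 ^+ 'C(i, 2).
have g0 i : 0 <= g i by rewrite exprn_ge0 // invr_ge0 ltW.
rewrite (eq_bigr (fun A' => c * g #|A :&: A'|)); last first.
  by move=> A' /andP[A'K _]; rewrite pair_prob_overlap.
rewrite -mulr_sumr ler_wpM2l //.
rewrite (partition_big (fun A' => A :&: A') (fun I => (I \subset A) && (I != set0))) /=; last first.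
  by move=> A' /andP[_ ->]; rewrite subsetIl.
apply: (le_trans (y := \sum_(I : {set 'I_n} | (I \subset A) && (I != set0))
   (k%:R / #|W|%:R) ^+ #|I| * ('C(#|W|, k))%:R * g #|I|)).
  apply: ler_sum => I /andP[IA _].
  rewrite (eq_bigr (fun=> g #|I|)); last by move=> A' /andP[_ /eqP ->].
  rewrite sumr_const -[_ *+ _]mulr_natl ler_wpM2r // expr_div_n mulrAC.
  rewrite ler_pdivlMr ?exprn_gt0 // -!natrX -!natrM ler_nat.
  apply: leq_trans (card_supersets_le (subset_trans IA AW) kW').
  rewrite leq_mul2r; apply/orP; right; apply/subset_leq_card/subsetP => A'.
  rewrite {1}/in_mem /= => /andP[/andP[A'K _] /eqP <-].
  by move: A'K; rewrite !inE subsetIr andbT.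
rewrite (sum_subsets_card (fun i => (k%:R / #|W|%:R) ^+ i * ('C(#|W|, k))%:R * g i) Ak).
(* For |I| = i + 1, bounding 'C(k, i+1) by k^(i+1) leaves x (x b)^i times the number of [k]-sets. *)
apply: (le_trans (y := \sum_(i < k) ('C(#|W|, k))%:R * (x * 2^-1 ^+ i))).
  apply: ler_sum => i _.
  have bin_le : ('C(k, i.+1))%:R <= k%:R ^+ i.+1 :> R.
    rewrite -natrX ler_nat -(@leq_pmul2r (i.+1)`!) ?fact_gt0 // bin_ffact.
    apply: leq_trans (_ : k ^ i.+1 <= _)%N; last by rewrite leq_pmulr ?fact_gt0.
    elim: (i.+1) {g0} => [|j IH]; first by rewrite ffactn0.
    by rewrite ffactnSr expnSr leq_mul // leq_subr.
  apply: (le_trans (y := k%:R ^+ i.+1 * ((k%:R / #|W|%:R) ^+ i.+1 * ('C(#|W|, k))%:R * b ^+ i))).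
    apply: ler_pM => //.
      by rewrite !mulr_ge0 // exprn_ge0 // divr_ge0 // ltW.
    rewrite ler_wpM2l ?hb // mulr_ge0 // exprn_ge0 // divr_ge0 // ltW //.
  rewrite [X in X <= _](_ : _ = ('C(#|W|, k))%:R * (x * (x * b) ^+ i)); last first.
    have -> : x = k%:R * (k%:R / #|W|%:R) by rewrite /x expr2 mulrA.
    by move: (k%:R / _) => a; rewrite !exprMn !exprS; ring.
  rewrite ler_wpM2l // ler_wpM2l // lerXn2r ?nnegrE ?mulr_ge0 ?invr_ge0 //.
rewrite -mulr_sumr -mulr_sumr ler_wpM2l // [2 * x]mulrC ler_wpM2l //.
have := subrX1 (2^-1 : R) k; have : 0 <= (2^-1 : R) ^+ k by rewrite exprn_ge0 // invr_ge0.
lra.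
Qed.

(** Chebyshev gives more than mu/2 cliques except with probability 8x, and Markov gives fewer than 2
    w x mu^2 meeting pairs except with probability 1/w. [large_disjoint_subfamily] then yields more
    than (mu^2/4) / (8 w x mu^2) = 1/(32 w x) disjoint cliques. *)
Lemma clique_family_tail (b w : R) (M : nat) : 0 <= b -> x * b <= 2^-1 ->
  (forall i, (i < k)%N -> p^-1 ^+ 'C(i.+1, 2) <= b ^+ i) ->
  0 < w -> M%:R * (32 * w * x) <= 1 ->
  Pr p (fun F => ~~ [exists D, clique_family W k M F D]) <= 8 * x + w^-1.
Proof.
move=> b0 xb hb w0 hM; have /andP[p0 p1] := p01; have /andP[k0 kW'] := kW.
have EQ := Ex_meeting_le b0 xb hb.
have mu0 : 0 < mu by rewrite mulr_gt0 ?exprn_gt0 // ltr0n bin_gt0.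
have x0 : 0 < x by rewrite divr_gt0 ?exprn_gt0 ?ltr0n //; lia.
pose Z F := #|kcliques F|%:R : R; pose Q F := #|meeting (kcliques F)|%:R : R.
have var : Ex p (fun F => (Z F - mu) ^+ 2) <= 2 * x * mu ^+ 2.
  have -> : Ex p (fun F => (Z F - mu) ^+ 2) = Ex p (fun F => Z F ^+ 2) - mu ^+ 2.
    rewrite (eq_Ex _ (h2 := fun F => Z F ^+ 2 + ((- 2 * mu) * Z F + mu ^+ 2))); last first.
      by move=> F; ring.
    by rewrite ExD ExD ExZ Ex_kcliques Ex_cst; ring.
  by rewrite lerBlDl; apply: le_trans Ex_kcliques_sqr _; rewrite lerD2l.
have c1 : 0 < mu ^+ 2 / 4 by rewrite divr_gt0 ?exprn_gt0.
have c2 : 0 < w * (2 * x * mu ^+ 2).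
  by apply: mulr_gt0 => //; apply: mulr_gt0; [apply: mulr_gt0 | apply: exprn_gt0].
have P1 := markov p01' (h := fun F => (Z F - mu) ^+ 2) (fun F => sqr_ge0 _) c1.
have P2 := markov p01' (h := Q) (fun F => ler0n _ _) c2.
have P1' : Ex p (fun F => (Z F - mu) ^+ 2) / (mu ^+ 2 / 4) <= 8 * x.
  rewrite ler_pdivrMr //; apply: le_trans var _.
  by rewrite le_eqVlt; apply/orP; left; apply/eqP; field.
have P2' : Ex p Q / (w * (2 * x * mu ^+ 2)) <= w^-1.
  by rewrite ler_pdivrMr //; apply: le_trans EQ _; rewrite mulKf // gt_eqF.
apply: le_trans (lerD (le_trans P1 P1') (le_trans P2 P2')).
apply: Pr_le_or => // F; apply: contraNT; rewrite negb_or -!ltNge => /andP[hZ hQ].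
have C0 : set0 \notin kcliques F.
  by rewrite !in_set cards0 (ltn_eqF k0) andbF.
have [D [DC tD hD]] := large_disjoint_subfamily C0.
apply/existsP; exists D; apply/and3P; split => //; last first.
  apply/forall_inP => A /(subsetP DC); rewrite in_set => /andP[+ ->].
  by rewrite in_set => /andP[-> ->].
rewrite leqNgt; apply/negP => DM.
have hDR : Z F ^+ 2 <= 4 * #|D|%:R * Q F.
  by rewrite /Z /Q -natrX -!natrM ler_nat.
have Zlow : mu ^+ 2 / 4 < Z F ^+ 2 by apply: half_lt_of_close.
have DM' : #|D|%:R <= M%:R :> R by rewrite ler_nat ltnW.
have Q0 : 0 <= Q F by rewrite ler0n.
have : Z F ^+ 2 <= 4 * M%:R * (w * (2 * x * mu ^+ 2)).
  apply: le_trans hDR _; rewrite ler_pM ?mulr_ge0 ?ler_wpM2l // ltW //.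
have : 4 * M%:R * (w * (2 * x * mu ^+ 2)) <= mu ^+ 2 / 4.
  have -> : 4 * M%:R * (w * (2 * x * mu ^+ 2)) = (M%:R * (32 * w * x)) * (mu ^+ 2 / 4) by field.
  by rewrite -[X in _ <= X]mul1r ler_wpM2r // ltW.
move=> h1 h2; have := lt_le_trans Zlow (le_trans h2 h1); by rewrite ltxx.
Qed.

End SecondMoment.

(** * Rate constants *)

(** [d] is a mode of Bin(k, q). The largest of k + 1 probabilities of sum 1 is at least 1/(k+1), and
    comparison with the two neighbouring terms locates [d] near kq. This serves in place of
    Stirling's formula. *)
Lemma binomial_mode (R : realFieldType) (k : nat) (q : R) : 0 < q < 1 ->
  exists d : nat, [/\ (d <= k)%N, k%:R * q - 1 <= d%:R, d%:R <= (k%:R + 1) * q &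
    1 <= (k%:R + 1) * (('C(k, d))%:R * (q ^+ d * (1 - q) ^+ (k - d)))].
Proof.
move=> /andP[q0 q1]; have q1' : 0 < 1 - q by lra.
pose f i : R := ('C(k, i))%:R * (q ^+ i * (1 - q) ^+ (k - i)).
have sum_f : \sum_(i < k.+1) f i = 1.
  rewrite -[RHS](expr1n _ k) -[X in X ^+ k](subrK q 1) exprDn; apply: eq_bigr => i _.
  by rewrite /f mulr_natl [q ^+ _ * _]mulrC.
have f0 i : (i <= k)%N -> 0 < f i.
  by move=> ik; rewrite /f !mulr_gt0 ?exprn_gt0 // ltr0n bin_gt0.
have step i : (i < k)%N -> f i.+1 * (i.+1%:R * (1 - q)) = f i * ((k%:R - i%:R) * q).
  move=> ik; rewrite -natrB ?(ltnW ik) // /f.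
  have -> : (k - i = (k - i.+1).+1)%N by lia.
  have e : (i.+1)%:R * ('C(k, i.+1))%:R = (k - i.+1).+1%:R * ('C(k, i))%:R :> R.
    by rewrite -!natrM mul_bin_left; congr (_ * _)%:R; lia.
  rewrite !exprS; set a := q ^+ i; set b := (1 - q) ^+ _.
  transitivity (i.+1%:R * ('C(k, i.+1))%:R * (q * a * b * (1 - q))); first by ring.
  by rewrite e; ring.
pose d := [arg max_(i > ord0 : 'I_k.+1) f i]%O.
have dmax (i : 'I_k.+1) : f i <= f d by rewrite /d; case: arg_maxP => // j _; apply.
have dk : (d <= k)%N by rewrite -ltnS.
exists d; split => //.
- have [dk'|kd] := ltnP d k; last first.
    have : k%:R <= d%:R :> R by rewrite ler_nat.
    have : 0 <= k%:R * (1 - q) by rewrite mulr_ge0 // ltW.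
    by lra.
  have h : (k%:R - d%:R) * q <= d.+1%:R * (1 - q).
    rewrite -(ler_pM2l (f0 _ dk)) -step // ler_wpM2r ?mulr_ge0 ?(ltW q1') //.
    exact: (dmax (Ordinal (dk' : (d.+1 < k.+1)%N))).
  by move: h; rewrite -natr1; lra.
- have [d0|d0] := posnP d; first by rewrite d0 mulr_ge0 ?(ltW q0) // addr_ge0.
  have dk1 : (d.-1 < k)%N by lia.
  have e : (d.-1.+1 = d)%N by lia.
  have := step _ dk1; rewrite e => st.
  have h : d%:R * (1 - q) <= (k%:R - d.-1%:R) * q.
    rewrite -(ler_pM2l (f0 _ dk)) st ler_wpM2r //.
      by rewrite mulr_ge0 ?(ltW q0) // subr_ge0 ler_nat ltnW.
    exact: (dmax (Ordinal (ltnW (dk1 : (d.-1.+1 < k.+1)%N)))).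
  move: h; have -> : d.-1%:R = d%:R - 1 :> R by rewrite -{2}e -natr1; lra.
  by lra.
rewrite -[X in X <= _]sum_f; apply: le_trans (ler_sum (G := fun=> f d) _ _) _.
  by move=> i _; apply: dmax.
by rewrite sumr_const card_ord -[X in X <= _]mulr_natl -natr1.
Qed.

Section Rate.
Variables (R : realType) (p q lam c beta : R).

(* [expR lam] tilts Bin(., p) to Bin(., q); the last clause says that the
   relative entropy [q * lam - c] of [q] with respect to [p] is [beta / 2],
   i.e. P(Bin(2 log_{1/p} n, p) >= gamma log_{1/p} n) is about 1/n. *)
Definition rate_constants :=
  [/\ 0 < q < 1, 0 < beta, 0 < lam & 0 < c] /\
  [/\ p = expR (- beta), p = q * expR (c - lam), 1 - p = (1 - q) * expR c
     & q * lam - c = beta / 2].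

Hypothesis rc : rate_constants.

(** The exact likelihood ratio between Bin(k, p) and Bin(k, q) at [d]. *)
Lemma binomial_tilt (k d : nat) : (d <= k)%N ->
  p ^+ d * (1 - p) ^+ (k - d) =
  q ^+ d * (1 - q) ^+ (k - d) * expR (c * k%:R - lam * d%:R).
Proof.
move=> dk; have [_ [_ -> -> _]] := rc.
rewrite !exprMn -!expRM_natr mulrACA -expRD natrB //; congr (_ * expR _); ring.
Qed.

End Rate.

(** Take q = gamma/2, c = ln((1-p)/(1-q)) and let lam be the log odds ratio of q and p; both are
    positive because p < q. The terms in ln 2 cancel and the equation becomes the entropy
    identity. *)
Lemma rate_constants_exist (R : realType) (p gamma : R) : 0 < p < 1 ->
  Num.max 1 (2 * p) < gamma < 2 ->
  gamma * ln (2 / gamma) + (2 - gamma) * ln (2 / (2 - gamma))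
    = (2 - gamma) * ln (1 / (1 - p)) - (1 - gamma) * ln (1 / p) ->
  exists q lam c, gamma = 2 * q /\ rate_constants p q lam c (ln (1 / p)).
Proof.
move=> /andP[p0 p1] /andP[]; rewrite gt_max => /andP[g1 gp] g2.
pose q := gamma / 2; have gE : gamma = 2 * q by rewrite /q; lra.
have [q0 q1 pq] : [/\ 0 < q, 0 < 1 - q & p < q] by rewrite /q; split; lra.
have p1' : 0 < 1 - p by lra.
have -> : 2 - gamma = 2 * (1 - q) by rewrite gE; ring.
rewrite !ln_div ?posrE ?mulr_gt0 //; last by lra.
have lg : ln gamma = ln 2 + ln q by rewrite gE lnM ?posrE.
have lg' : ln (2 * (1 - q)) = ln 2 + ln (1 - q) by rewrite lnM ?posrE.
rewrite lg lg' ln1 => eqn.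
exists q, (ln (1 - p) - ln (1 - q) - (ln p - ln q)), (ln (1 - p) - ln (1 - q)).
split => //; rewrite !sub0r.
have lp : ln p < ln q by rewrite ltr_ln ?posrE.
have l1p : ln (1 - q) < ln (1 - p) by rewrite ltr_ln ?posrE //; lra.
have lp0 : ln p < 0 by rewrite -ln1 ltr_ln ?posrE.
split; first by split; [apply/andP; split; lra|lra..].
split.
- by rewrite opprK lnK ?posrE.
- by rewrite opprB addrCA subrr addr0 expRB !lnK ?posrE // mulrCA divff ?mulr1 // gt_eqF.
- by rewrite expRB !lnK ?posrE // mulrCA divff ?mulr1 // gt_eqF.
by move: eqn; rewrite gE; lra.
Qed.

(** In the estimates below [t] stands for ln n and [u] for ln ln n, known only through [expR u = t]
    and [expR t = n%:R]. *)
Lemma lnln_large (R : realType) (A : R) : exists N : nat, forall n : nat, (N <= n)%N ->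
  [/\ A <= ln (ln n%:R) :> R, expR (ln (ln n%:R)) = ln n%:R :> R & expR (ln n%:R) = n%:R :> R].
Proof.
exists (Num.truncn (expR (expR A))).+1 => n nN.
have h : expR (expR A) <= n%:R.
  by apply: ltW; apply: lt_le_trans (truncnS_gt _) _; rewrite ler_nat.
have n0 : 0 < n%:R :> R by apply: lt_le_trans h; apply: expR_gt0.
have h1 : expR A <= ln n%:R by rewrite -(expRK (expR A)) ler_ln ?posrE ?expR_gt0.
have t0 : 0 < ln n%:R :> R by apply: lt_le_trans h1; apply: expR_gt0.
by split; rewrite ?lnK ?posrE // -(expRK A) ler_ln ?posrE ?expR_gt0.
Qed.

(** * Asymptotics *)

Lemma expRN_le_inv (R : realType) (y : R) : 0 < y -> expR (- y) <= y^-1.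
Proof.
move=> y0; rewrite expRN lef_pV2 ?posrE ?expR_gt0 //.
by have := expR_ge1Dx y; lra.
Qed.

Lemma expR_bin2 (R : realType) (b : R) (i : nat) :
  expR b ^+ 'C(i.+1, 2) = expR (b * (i.+1%:R * i%:R) / 2).
Proof.
rewrite -expRM_natr; congr expR.
have : ('C(i.+1, 2))%:R * 2 = i.+1%:R * i%:R :> R.
  by rewrite -[2 in LHS]/(2%:R) -!natrM -[2%N]/(2`!)%N bin_ffact ffactnS ffactn1.
by move=> <-; field.
Qed.

(** * Estimates for the upper tail *)

Section Upper.
Variables (R : realType) (p q lam c beta : R).
Hypothesis rc : rate_constants p q lam c beta.

(** The powers of n and p combine to exp((j+1)(t - beta j/2)), at most 1 here; the factorial in the
    binomial coefficient supplies the decay. *)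
Lemma clique_mean_le (n j : nat) (t : R) : expR t = n%:R -> 2 * t / beta <= j%:R ->
  ('C(n, j.+1))%:R * p ^+ 'C(j.+1, 2) <= j.+1%:R^-1.
Proof.
have [[_ b0 _ _] [-> _ _ _]] := rc => tn tj.
have j0 : 0 < (j.+1)%:R :> R by rewrite ltr0n.
have f0 : 0 < (j.+1)`!%:R :> R by rewrite ltr0n fact_gt0.
apply: (le_trans (y := (j.+1)`!%:R^-1)); last first.
  by rewrite lef_pV2 ?posrE // ler_nat fact_geq.
rewrite -(ler_pM2r f0) mulVf ?gt_eqF // mulrAC -natrM bin_ffact.
have hf : (n ^_ j.+1)%:R <= n%:R ^+ j.+1 :> R.
  rewrite -natrX ler_nat; elim: (j.+1) => [|i IH]; first by rewrite ffactn0.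
  by rewrite ffactnSr expnSr leq_mul // leq_subr.
apply: le_trans (ler_wpM2r _ hf) _; first by rewrite exprn_ge0 // expR_ge0.
rewrite -tn -expRM_natr expR_bin2 -expRD -[X in _ <= X]expR0 ler_expR.
have : 0 <= j.+1%:R * (beta * j%:R - 2 * t).
  by rewrite mulr_ge0 // subr_ge0 [beta * _]mulrC -ler_pdivrMr.
by lra.
Qed.

Lemma upper_asymp (eps : R) : 0 < eps -> exists A : R, forall (n : nat) (t u : R),
  expR u = t -> expR t = n%:R -> A <= u ->
  Pr p (fun F : {set 'I_n * 'I_n} => 2 * q * n%:R * (t / beta) + 10 * n%:R * (u / beta)
     < (max_chordal (F :&: edge_pairs n))%:R) <= eps.
Proof.
move=> e0; have [[/andP[q0 q1] b0 l0 c0] [pb pE p1E kl]] := rc.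
(* In order: u is at least 1; the clique term is at most eps/2; the linear terms are absorbed;
   e^(-n) is at most eps/2. *)
exists (1 + beta / eps + beta * (2 + c + lam) / (10 * lam) + 2 / eps) => n t u ut tn Au.
have T1 : 0 < beta / eps by rewrite divr_gt0.
have T2 : 0 < beta * (2 + c + lam) / (10 * lam) by rewrite divr_gt0 ?mulr_gt0 ?addr_gt0.
have T3 : 0 < 2 / eps by rewrite divr_gt0.
have u1 : 1 <= u by lra.
have tu : u <= t by rewrite -ut; have := expR_ge1Dx u; lra.
have nt : t <= n%:R by rewrite -tn; have := expR_ge1Dx t; lra.
have p0 : 0 < p by rewrite pb expR_gt0.
have p01 : 0 <= p <= 1.
  by rewrite ltW //= pb -expR0 ler_expR; lra.
pose y := 2 * t / beta; have y0 : 0 <= y by rewrite /y divr_ge0 ?mulr_ge0 // ?(ltW b0) //; lra.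
pose kappa := (Num.truncn y).+1.
have [K1 K2] : y <= kappa%:R /\ kappa%:R <= y + 1.
  have := truncnS_gt y; have : (Num.truncn y)%:R <= y by rewrite truncn_le.
  by rewrite /kappa -natr1; lra.
pose x0 := 2 * q * n%:R * (t / beta) + 10 * n%:R * (u / beta).
have x00 : 0 <= x0.
  have t0 : 0 <= t / beta by rewrite divr_ge0 // ?(ltW b0) //; lra.
  have u0 : 0 <= u / beta by rewrite divr_ge0 // ?(ltW b0) //; lra.
  by apply: addr_ge0; apply: mulr_ge0 => //; rewrite !mulr_ge0 //; lra.
pose m := Num.truncn x0.
have M1 : x0 - 1 <= m%:R by have := truncnS_gt x0; rewrite -natr1 -/m; lra.
apply: le_trans (Pr_le p01 (A2 := fun F => (m < max_chordal (F :&: edge_pairs n))%N) _) _.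
  by move=> F; rewrite /m truncn_lt_nat.
have z1 : 1 <= expR lam by rewrite -expR0 ler_expR ltW.
have tail := @max_chordal_upper_tail n R p p01 kappa m (expR lam) z1.
apply: (le_trans tail).
have h1 : ('C(n, kappa.+1))%:R * p ^+ 'C(kappa.+1, 2) <= eps / 2.
  apply: le_trans (clique_mean_le tn K1) _.
  rewrite -[eps / 2]invrK lef_pV2 ?posrE ?invr_gt0 ?divr_gt0 // invf_div.
  have : 2 / eps <= y.
    rewrite /y ler_pdivlMr // mulrC; have : beta / eps <= t by lra.
    lra.
  by rewrite -natr1; lra.
suff h2 : n.+1%:R ^+ n * (1 - p + p * expR lam) ^+ (kappa * n) / expR lam ^+ m <= eps / 2 by lra.
(* By the tilting relations this is (1-q) e^c + q e^c. *)
have -> : 1 - p + p * expR lam = expR c.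
  by rewrite p1E {1}pE -mulrA -expRD subrK; ring.
have n1 : n.+1%:R <= expR (t + 1).
  rewrite expRD tn -natr1; have := expR_ge1Dx (1 : R) => h.
  have : n%:R * (1 + 1) <= n%:R * expR 1 :> R by rewrite ler_wpM2l.
  lra.
have h3 : n.+1%:R ^+ n <= expR (t + 1) ^+ n by rewrite lerXn2r ?nnegrE ?expR_ge0.
rewrite -mulrA; apply: le_trans (ler_wpM2r _ h3) _.
  by rewrite divr_ge0 ?exprn_ge0 ?expR_ge0.
rewrite -!expRM_natr -expRN -!expRD.
apply: (le_trans (y := expR (- n%:R))); last first.
  apply: le_trans (expRN_le_inv _) _; first by lra.
  rewrite -[eps / 2]invrK lef_pV2 ?posrE ?invr_gt0 ?divr_gt0 // ?invf_div; lra.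
rewrite ler_expR natrM.
have N1 : 1 <= n%:R :> R by lra.
have H1 : 0 <= c * n%:R * (y + 1 - kappa%:R) by rewrite mulr_ge0 ?mulr_ge0 ?(ltW c0) //; lra.
have H2 : 0 <= lam * (m%:R - (x0 - 1)) by rewrite mulr_ge0 ?(ltW l0) //; lra.
have H3 : 0 <= (10 * lam * (u / beta) - (2 + c + lam)) * n%:R.
  rewrite mulr_ge0 // subr_ge0.
  have : beta * (2 + c + lam) / (10 * lam) <= u by lra.
  by rewrite ler_pdivrMr ?mulr_gt0 // mulrA ler_pdivlMr //; lra.
have H4 : 0 <= lam * (n%:R - 1) by rewrite mulr_ge0 ?(ltW l0) //; lra.
(* The entropy identity: the term n t from counting parent functions is paid for exactly. *)
have e1 : 2 * (q * lam) * (n%:R * (t / beta)) = 2 * c * (n%:R * (t / beta)) + n%:R * t.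
  have -> : q * lam = c + beta / 2 by lra.
  by field; rewrite gt_eqF.
rewrite /x0 in H2; rewrite /y in H1.
have yE : 2 * t / beta = 2 * (t / beta) by rewrite mulrA.
rewrite yE in H1.
lra.
Qed.

End Upper.

(** * Estimates for the lower tail *)

Section Lower.
Variables (R : realType) (p q lam c beta : R).
Hypothesis rc : rate_constants p q lam c beta.

(** The mode of Bin(k, q) costs 1/(k+1), at least (beta/2) e^(-u), and the tilt costs e^(-k beta/2 -
    lam q), at least e^(9u/2 - t - lam q). Together they leave 7u/2 - t in the exponent. *)
Lemma attach_prob_ge (k d : nat) (t u : R) : expR u = t -> 0 < t -> beta <= 9 * u ->
  k%:R <= (2 * t - 9 * u) / beta -> (d <= k)%N -> d%:R <= (k%:R + 1) * q ->
  1 <= (k%:R + 1) * (('C(k, d))%:R * (q ^+ d * (1 - q) ^+ (k - d))) ->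
  beta / 2 * expR (- (lam * q)) * expR (7 / 2 * u - t) <=
    ('C(k, d))%:R * p ^+ d * (1 - p) ^+ (k - d).
Proof.
have [[/andP[q0 q1] b0 l0 c0] [_ _ _ kl]] := rc.
move=> ut t0 bu hk dk hd ha; rewrite -[X in _ <= X]mulrA (binomial_tilt rc dk) [X in _ <= X]mulrA.
set a := (_ * (q ^+ d * _)) in ha *.
rewrite ler_pdivlMr // in hk.
have k1 : 0 < k%:R + 1 :> R by rewrite ltr_wpDl.
have kt : (k%:R + 1) * beta <= 2 * t by lra.
have a1 : beta / 2 * expR (- u) <= a.
  rewrite expRN ut -(ler_pM2l k1); apply: le_trans ha.
  rewrite mulrA ler_pdivrMr // mul1r; lra.
have e1 : expR (- (lam * q) + (9 / 2 * u - t)) <= expR (c * k%:R - lam * d%:R).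
  rewrite ler_expR.
  have h1 : 0 <= lam * ((k%:R + 1) * q - d%:R) by rewrite mulr_ge0 ?(ltW l0) ?subr_ge0.
  have h2 : k%:R * (q * lam) = k%:R * c + k%:R * beta / 2.
    have -> : q * lam = c + beta / 2 by lra.
    by ring.
  lra.
have g0 : 0 <= beta / 2 * expR (- u) by rewrite mulr_ge0 ?expR_ge0 // divr_ge0 // ltW.
apply: le_trans (ler_pM g0 (expR_ge0 _) a1 e1).
rewrite -!mulrA ler_wpM2l ?(ltW b0) // ler_wpM2l ?invr_ge0 ?ler0n //.
by rewrite -!expRD ler_expR; lra.
Qed.

(** Of the 10 u/beta, nine come from the shortfall of k below 2t/beta. The tenth pays for rounding
    (2 per vertex) and for the at most 3n/t lost vertices of at most 2t/beta edges each, that is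
    6/beta per vertex. *)
Lemma edge_count_ge (n n1 b0 k d : nat) (t u : R) :
  0 < t -> 2 <= t -> 0 <= u -> 2 * beta + 6 <= u -> t <= n%:R ->
  n1%:R <= 2 * n%:R / t -> b0%:R <= n%:R / t ->
  (2 * t - 9 * u) / beta < k%:R + 1 -> k%:R + 1 <= 2 * t / beta ->
  k%:R * q - 1 <= d%:R -> d%:R <= (k%:R + 1) * q ->
  2 * q * n%:R * (t / beta) - 10 * n%:R * (u / beta) <= ((n - n1 - b0) * d)%:R.
Proof.
have [[/andP[q0 q1] be0 l0 c0] _] := rc.
move=> t0 t2 u0 ub tn hn1 hb0 hk1 hk2 hd1 hd2.
have d0 : 0 <= d%:R :> R by [].
(* Subtraction in nat is truncated, but the real difference is a lower bound in either case. *)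
have h1 : n%:R - n1%:R - b0%:R <= (n - n1 - b0)%:R :> R.
  rewrite -subnDA; have [h|h] := leqP (n1 + b0) n; first by rewrite natrB // natrD opprD addrA.
  have : n%:R <= (n1 + b0)%:R :> R by rewrite ler_nat ltnW.
  have : 0 <= (n - (n1 + b0))%:R :> R by [].
  by rewrite natrD; lra.
rewrite natrM; apply: le_trans (ler_wpM2r d0 h1).
have dt : d%:R <= 2 * (t / beta).
  apply: le_trans hd2 _; rewrite mulrA; apply: le_trans hk2.
  by rewrite ler_piMr ?(ltW q1) // addr_ge0.
pose s := t / beta; pose v := u / beta; pose r := n%:R / t.
have rt : r * s = n%:R / beta by rewrite /r /s; field; rewrite !gt_eqF.
have r0 : 0 <= r by rewrite divr_ge0 // ltW.
have s0 : 0 <= s by rewrite divr_ge0 // ltW.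
have v0 : 0 <= v by rewrite divr_ge0 // ltW.
have loss : (n1%:R + b0%:R) * d%:R <= 6 * (n%:R / beta).
  rewrite -rt; apply: le_trans (ler_pM _ d0 _ dt) _; first by rewrite addr_ge0.
    by apply: lerD hn1 hb0.
  rewrite -/s -mulrA -/r le_eqVlt; apply/orP; left; apply/eqP; ring.
have vb : 2 + 6 / beta <= v.
  by rewrite /v ler_pdivlMr // mulrDl divfK ?gt_eqF.
have k2 : 2 * s - 9 * v < k%:R + 1.
  by move: hk1; rewrite mulrBl -!mulrA.
have hd3 : 2 * q * s - 9 * v - 2 <= d%:R.
  have hq : 0 <= q * (k%:R + 1 - (2 * s - 9 * v)) by rewrite mulr_ge0 ?(ltW q0) //; lra.
  have hv : 0 <= (1 - q) * v by rewrite mulr_ge0 //; lra.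
  lra.
have N1 : 0 <= n%:R * (d%:R - (2 * q * s - 9 * v - 2)) by rewrite mulr_ge0 // subr_ge0.
have N2 : 0 <= n%:R * (v - (2 + 6 / beta)) by rewrite mulr_ge0 // subr_ge0.
rewrite -/s -/v; lra.
Qed.


Lemma lower_growth (n : nat) (t u : R) : expR u = t -> expR t = n%:R ->
  20 + 3 * beta <= u ->
  [/\ 10 * u + beta * u <= t, t * t * t / 6 <= n%:R & t <= n%:R].
Proof.
have [[_ b0 _ _] _] := rc; move=> ut tn ub.
have u0 : 0 <= u by lra.
have tu2 : u * u / 2 <= t.
  by rewrite -ut; have := expR_ge1Dxn 1 u0; rewrite expr2 (_ : 2`!%:R = 2 :> R) //; lra.
have tu : 10 * u + beta * u <= t.
  have : 0 <= u * (u - (20 + 2 * beta)) by rewrite mulr_ge0 //; lra.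
  by lra.
have t0 : 0 <= t by rewrite -ut expR_ge0.
split => //; last by rewrite -tn; have := expR_ge1Dx t; lra.
rewrite -tn; have := expR_ge1Dxn 2 t0.
by rewrite !exprS expr0 mulr1 (_ : 3`!%:R = 6 :> R) // mulrA; lra.
Qed.

(** With b1 the integer part of n/t: b1 + 1 vertices are reserved for cliques and b1 may stay
    unattached; k is the integer part of (2t - 9u)/beta. *)
Lemma lower_sizes (n : nat) (t u : R) : 0 < u ->
  10 * u + beta * u <= t -> t * t * t / 6 <= n%:R -> t <= n%:R ->
  20 + 3 * beta <= u -> 12 / beta <= u ->
  exists n1 b1 k : nat,
    [/\ n1%:R <= 2 * n%:R / t, n%:R / t <= n1%:R, b1%:R <= n%:R / t,
        n%:R / t <= b1.+1%:R & (n1 <= n)%N] /\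
    [/\ (0 < k <= n1)%N, k%:R <= (2 * t - 9 * u) / beta,
        (2 * t - 9 * u) / beta < k%:R + 1 & k%:R + 1 <= 2 * t / beta].
Proof.
have [[_ be0 _ _] _] := rc; move=> u0 tu nt3 nt ub u12.
have bu0 : 0 < beta * u by rewrite mulr_gt0.
have t12 : 12 / beta <= t by lra.
have t2 : 2 <= t by lra.
have t0 : 0 < t by lra.
pose r := n%:R / t; rewrite -mulrA -/r.
have r1 : 1 <= r by rewrite /r ler_pdivlMr ?mul1r.
pose b1 := Num.truncn r.
have hb1 : b1%:R <= r by rewrite truncn_le; lra.
have hb1' : r < b1.+1%:R by rewrite truncnS_gt.
have n1r : b1.+1%:R <= 2 * r by rewrite -natr1; lra.
have n1n : (b1.+1 <= n)%N.
  rewrite -(ler_nat R); apply: le_trans n1r _; rewrite /r mulrA ler_pdivrMr //.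
  by rewrite mulrC ler_wpM2l.
pose y := (2 * t - 9 * u) / beta.
have y1 : 1 <= y.
  have : 0 <= beta * (u - 1) by apply: mulr_ge0; lra.
  by rewrite /y ler_pdivlMr // mul1r; lra.
pose k := Num.truncn y.
have hk : k%:R <= y by rewrite truncn_le; lra.
have hk' : y < k%:R + 1 by rewrite natr1 truncnS_gt.
have k0 : (0 < k)%N by rewrite truncn_gt0.
have k2t : k%:R + 1 <= 2 * t / beta.
  apply: le_trans (_ : y + 1 <= _); first by rewrite lerD2r.
  by rewrite /y ler_pdivlMr // mulrDl divfK ?gt_eqF //; lra.
exists b1.+1, b1, k; split; split => //; first exact: ltW.
  exact: ltW.
rewrite k0 -(ler_nat R); apply: le_trans (_ : 2 * t / beta <= _); first by lra.
apply: le_trans (ltW hb1'); rewrite /r ler_pdivlMr //; apply: le_trans nt3.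
rewrite (_ : 2 * t / beta * t = t * t * (12 / beta) / 6); last by field; rewrite gt_eqF.
by rewrite ler_pM2r ?invr_gt0 // ler_wpM2l // mulr_ge0 // ltW.
Qed.

Lemma overlap_le (n n1 k : nat) (t u : R) : expR u = t -> expR t = n%:R ->
  n%:R / t <= n1%:R -> k%:R + 1 <= 2 * t / beta ->
  k%:R ^+ 2 / n1%:R <= 4 / beta ^+ 2 * expR (3 * u - t).
Proof.
have [[_ be0 _ _] _] := rc; move=> ut tn hn1 hk.
have t0 : 0 < t by rewrite -ut expR_gt0.
have n0 : 0 < n%:R :> R by rewrite -tn expR_gt0.
have r0 : 0 < n%:R / t by rewrite divr_gt0.
have -> : 4 / beta ^+ 2 * expR (3 * u - t) = (2 * t / beta) ^+ 2 / (n%:R / t).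
  by rewrite expRB expRM_natl ut tn; field; rewrite !gt_eqF.
apply: ler_pM; rewrite ?exprn_ge0 ?invr_ge0 //.
  have hk2 : k%:R <= 2 * t / beta by lra.
  by rewrite lerXn2r ?nnegrE // (le_trans _ hk2).
by rewrite lef_pV2 ?posrE // (lt_le_trans r0).
Qed.

(** Since 'C(i+1, 2) = i(i+1)/2 is at most i k/2, the base p^(-k/2) works, and it is at most e^(t -
    9u/2). *)
Lemma inv_pow_bin2_le (k : nat) (t u : R) : k%:R <= (2 * t - 9 * u) / beta ->
  forall i, (i < k)%N -> p^-1 ^+ 'C(i.+1, 2) <= expR (t - 9 / 2 * u) ^+ i.
Proof.
have [[_ be0 _ _] [-> _ _ _]] := rc; move=> hk i ik.
rewrite -expRN opprK expR_bin2 -expRM_natr ler_expR.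
have ik' : i.+1%:R <= k%:R :> R by rewrite ler_nat.
have h : i.+1%:R * beta <= 2 * t - 9 * u by rewrite -ler_pdivlMr // (le_trans ik').
have : 0 <= i%:R * (2 * t - 9 * u - i.+1%:R * beta) by rewrite mulr_ge0 // subr_ge0.
lra.
Qed.

(** The 9u/2 taken off the exponent outweighs the 3u in the bound on [x]. *)
Lemma overlap_small (x t u : R) : 0 < u -> 8 / beta ^+ 2 <= u ->
  x <= 4 / beta ^+ 2 * expR (3 * u - t) -> x * expR (t - 9 / 2 * u) <= 2^-1.
Proof.
have [[_ be0 _ _] _] := rc; move=> u0 ub hx.
have g0 : 0 < beta ^+ 2 by rewrite exprn_gt0.
apply: le_trans (ler_wpM2r (expR_ge0 _) hx) _; rewrite -[X in X <= _]mulrA -expRD.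
apply: (le_trans (y := 4 / beta ^+ 2 * u^-1)).
  rewrite ler_wpM2l ?divr_ge0 ?(ltW g0) //; apply: le_trans (expRN_le_inv u0).
  by rewrite ler_expR; lra.
rewrite ler_pdivrMr //; have -> : 4 / beta ^+ 2 = 8 / beta ^+ 2 / 2 by field; rewrite gt_eqF.
lra.
Qed.

Lemma overlap_eps (eps x t u : R) : 0 < eps -> 0 < u -> 4 * u <= t ->
  128 / (beta ^+ 2 * eps) <= u ->
  x <= 4 / beta ^+ 2 * expR (3 * u - t) -> 8 * x <= eps / 4.
Proof.
have [[_ be0 _ _] _] := rc; move=> e0 u0 tu ub hx.
have g0 : 0 < beta ^+ 2 by rewrite exprn_gt0.
have h1 : expR (3 * u - t) <= u^-1.
  by apply: le_trans (expRN_le_inv u0); rewrite ler_expR; lra.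
have h2 : x <= 4 / beta ^+ 2 * u^-1.
  by apply: le_trans hx _; rewrite ler_wpM2l ?divr_ge0 ?(ltW g0).
have h3 : 4 / beta ^+ 2 * u^-1 <= eps / 32.
  rewrite ler_pdivrMr //.
  have -> : 4 / beta ^+ 2 = eps / 32 * (128 / (beta ^+ 2 * eps)) by field; rewrite !gt_eqF.
  by rewrite ler_wpM2l // divr_ge0 // ltW.
lra.
Qed.

(** The reciprocal is at least twice the claimed bound, which is itself at least 1, so taking the
    integer part is harmless. *)
Lemma family_size_ge (w x t u : R) : 0 < w -> 0 < x -> 4 * u <= t -> 0 < u ->
  256 * w / beta ^+ 2 <= u ->
  x <= 4 / beta ^+ 2 * expR (3 * u - t) ->
  beta ^+ 2 / (256 * w) * expR (t - 3 * u) <= (Num.truncn (32 * w * x)^-1)%:R.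
Proof.
have [[_ be0 _ _] _] := rc; move=> w0 x0 tu u0 ub hx.
have g0 : 0 < beta ^+ 2 by rewrite exprn_gt0.
have wx : 0 < 32 * w * x by rewrite mulr_gt0 // mulr_gt0 // ltr0n.
pose z := beta ^+ 2 / (256 * w) * expR (t - 3 * u).
have h1 : 2 * z <= (32 * w * x)^-1.
  rewrite -[2 * z]invrK lef_pV2 ?posrE ?invr_gt0 //; last first.
    by rewrite mulr_gt0 // mulr_gt0 ?expR_gt0 // divr_gt0 // mulr_gt0 // ltr0n.
  have -> : (2 * z)^-1 = 32 * w * (4 / beta ^+ 2 * expR (3 * u - t)).
    rewrite /z -[3 * u - t]opprB expRN; field; rewrite !gt_eqF ?expR_gt0 //.
  by rewrite ler_wpM2l // mulr_ge0 // ltW.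
have h2 : 1 <= z.
  have h3 : u <= expR (t - 3 * u).
    apply: le_trans (_ : expR u <= _); first by have := expR_ge1Dx u; lra.
    by rewrite ler_expR; lra.
  have h4 : 0 < beta ^+ 2 / (256 * w) by rewrite divr_gt0 // mulr_gt0 // ltr0n.
  apply: le_trans (ler_wpM2l (ltW h4) (le_trans ub h3)).
  by rewrite le_eqVlt; apply/orP; left; apply/eqP; field; rewrite !gt_eqF.
move: (truncnS_gt (32 * w * x)^-1) h1; rewrite -natr1 -/z.
move: (32 * w * x)^-1 => v; clearbody z; lra.
Qed.

(** (1-P)^M is at most exp(-a0 e^(u/2)), and e^(u/2) is at least u^2/8, so the exponent beats the
    factor n/(b1+1), at most e^u, by another e^u. *)
Lemma unattached_small (eps a0 P t u : R) (n M b1 : nat) : 0 < eps -> 0 < a0 ->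
  0 < u -> expR u = t -> expR t = n%:R -> 16 / a0 <= u -> 2 / eps <= u ->
  n%:R / t <= b1.+1%:R -> 0 <= P <= 1 -> a0 * expR (u / 2) <= P * M%:R ->
  n%:R * (1 - P) ^+ M / b1.+1%:R <= eps / 2.
Proof.
move=> e0 a00 u0 ut tn ua ue hb /andP[P0 P1] hPM.
have t0 : 0 < t by rewrite -ut expR_gt0.
have n0 : 0 < n%:R :> R by rewrite -tn expR_gt0.
have b0 : 0 < b1.+1%:R :> R by rewrite ltr0n.
have h1 : (1 - P) ^+ M <= expR (- (a0 * expR (u / 2))).
  apply: le_trans (_ : expR (- P) ^+ M <= _).
    rewrite lerXn2r ?nnegrE ?expR_ge0 ?subr_ge0 //.
    by have := expR_ge1Dx (- P).
  by rewrite -expRM_natr ler_expR mulNr lerN2.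
have h2 : n%:R * (1 - P) ^+ M / b1.+1%:R <= t * (1 - P) ^+ M.
  rewrite ler_pdivrMr // mulrAC ler_wpM2r ?exprn_ge0 ?subr_ge0 //.
  by rewrite mulrC -ler_pdivrMr.
apply: (le_trans h2); apply: (le_trans (ler_wpM2l (ltW t0) h1)).
rewrite -ut -expRD.
apply: (le_trans (y := expR (- u))); last first.
  apply: le_trans (expRN_le_inv u0) _.
  by rewrite -[eps / 2]invrK lef_pV2 ?posrE ?invr_gt0 ?divr_gt0 // invf_div.
rewrite ler_expR.
have h3 : u * u / 8 <= expR (u / 2).
  have u2 : 0 <= u / 2 by lra.
  by have := expR_ge1Dxn 1 u2; rewrite expr2 (_ : 2`!%:R = 2 :> R) //; lra.
have h4 : a0 * (u * u / 8) <= a0 * expR (u / 2) by rewrite ler_wpM2l // ltW.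
have h5 : 16 * u <= a0 * u * u.
  rewrite ler_wpM2r ?(ltW u0) // mulrC -ler_pdivrMr //.
lra.
Qed.

(** A vertex succeeds at one clique with probability of order at least e^(7u/2 - t), and there are
    at least about e^(t - 3u) cliques. The product e^(u/2) tends to infinity, which is what the 9 in
    the choice of k secures. *)
Lemma lower_asymp (eps : R) : 0 < eps -> exists A : R, forall (n : nat) (t u : R),
  expR u = t -> expR t = n%:R -> A <= u ->
  Pr p (fun F : {set 'I_n * 'I_n} => (max_chordal (F :&: edge_pairs n))%:R
     < 2 * q * n%:R * (t / beta) - 10 * n%:R * (u / beta)) <= eps.
Proof.
move=> e0; have [[q01 be0 l0 c0] [pb pE p1E kl]] := rc.
(* The failure probability splits as eps/4 (Chebyshev), 1/w = eps/4 (meeting pairs) and eps/2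
   (unattached vertices). *)
pose w : R := 4 / eps.
have w0 : 0 < w by rewrite divr_gt0.
have g0 : 0 < beta ^+ 2 by rewrite exprn_gt0.
have w256 : 0 < 256 * w by rewrite mulr_gt0 // ltr0n.
pose a0 := beta ^+ 2 / (256 * w) * (beta / 2 * expR (- (lam * q))).
have a00 : 0 < a0.
  by apply: mulr_gt0; [rewrite divr_gt0 | apply: mulr_gt0; rewrite ?expR_gt0 // divr_gt0].
pose B1 := 8 / beta ^+ 2; pose B2 := 128 / (beta ^+ 2 * eps).
pose B3 := 256 * w / beta ^+ 2; pose B4 := 16 / a0; pose B5 := 2 / eps.
have B10 : 0 < B1 by rewrite divr_gt0.
have B20 : 0 < B2 by rewrite divr_gt0 ?mulr_gt0.
have B30 : 0 < B3 by rewrite divr_gt0.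
have B40 : 0 < B4 by rewrite divr_gt0.
have B50 : 0 < B5 by rewrite divr_gt0.
have B60 : 0 < 12 / beta by rewrite divr_gt0.
exists (20 + 3 * beta + 12 / beta + B1 + B2 + B3 + B4 + B5) => n t u ut tn Au.
have [u20 [u3 u12]] : 20 <= u /\ 20 + 3 * beta <= u /\ 12 / beta <= u by lra.
have [uB1 [uB2 [uB3 [uB4 uB5]]]] : B1 <= u /\ B2 <= u /\ B3 <= u /\ B4 <= u /\ B5 <= u by lra.
have u0 : 0 < u by lra.
have ub26 : 2 * beta + 6 <= u by lra.
have b9u : beta <= 9 * u by lra.
clear Au B10 B20 B30 B40 B50 B60.
have [tu nt3 nt] := lower_growth ut tn u3.
have bu0 : 0 < beta * u by rewrite mulr_gt0.
have tu4 : 4 * u <= t by lra.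
have t2 : 2 <= t by lra.
have t0 : 0 < t by lra.
have p01' : 0 < p <= 1 by rewrite pb expR_gt0 -expR0 ler_expR; lra.
have p01 : 0 <= p <= 1 by case/andP: p01' => [/ltW -> ->].
have [n1 [b1 [k [[n1r rn1 b1r rb1 n1n] [kn1 hk hk' k2t]]]]] :=
  lower_sizes u0 tu nt3 nt u3 u12.
have [W Wn1] : exists W : {set 'I_n}, #|W| = n1.
  have : (n1 <= #|'I_n|)%N by rewrite card_ord.
  move=> /card_geqP[s [us ss _]]; exists [set x in s].
  by rewrite cardsE (card_uniqP us).
have kW : (0 < k <= #|W|)%N by rewrite Wn1.
have k0 : (0 < k)%N by case/andP: kn1.
have n10 : (0 < n1)%N by case/andP: kn1 => k0'; apply: leq_trans.
pose x : R := k%:R ^+ 2 / #|W|%:R.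
have x0 : 0 < x by rewrite /x Wn1 divr_gt0 ?exprn_gt0 ?ltr0n.
have xE : x <= 4 / beta ^+ 2 * expR (3 * u - t) by rewrite /x Wn1; apply: overlap_le ut tn rn1 k2t.
have xb := overlap_small u0 uB1 xE.
have x8 := overlap_eps e0 u0 tu4 uB2 xE.
pose M := Num.truncn (32 * w * x)^-1.
have M1 : M%:R * (32 * w * x) <= 1.
  have wx : 0 < 32 * w * x by rewrite mulr_gt0 // mulr_gt0 // ltr0n.
  by rewrite -ler_pdivlMr // div1r truncn_le invr_ge0 ltW.
have M2 := family_size_ge w0 x0 tu4 u0 uB3 xE.
have hb := inv_pow_bin2_le hk.
have T1 := clique_family_tail p01' kW (expR_ge0 _) xb hb w0 M1.
have [d [dk hd1 hd2 hd3]] := binomial_mode k q01.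
have P1 := attach_prob_ge ut t0 b9u hk dk hd2 hd3.
have P01 := binomial_prob_itv k d p01.
pose P := ('C(k, d))%:R * p ^+ d * (1 - p) ^+ (k - d).
rewrite -/P in P1 P01.
have PM : a0 * expR (u / 2) <= P * M%:R.
  have z1 : 0 <= beta / 2 * expR (- (lam * q)) * expR (7 / 2 * u - t).
    by rewrite mulr_ge0 ?expR_ge0 // mulr_ge0 ?expR_ge0 // divr_ge0 // ltW.
  have z2 : 0 <= beta ^+ 2 / (256 * w) * expR (t - 3 * u).
    by rewrite mulr_ge0 ?expR_ge0 // divr_ge0 // ltW.
  apply: (le_trans _ (ler_pM z1 z2 P1 M2)).
  have -> : u / 2 = (7 / 2 * u - t) + (t - 3 * u) by field.
  by rewrite [X in a0 * X]expRD /a0 le_eqVlt; apply/orP; left; apply/eqP; ring.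
have T2 := unattached_small e0 a00 u0 ut tn uB4 uB5 rb1 P01 PM.
have T := max_chordal_lower_tail p01 W k M d b1.
apply: le_trans
  (_ : Pr p (fun F => (max_chordal (F :&: edge_pairs n) < (n - #|W| - b1) * d)%N) <= _).
  apply: Pr_le => // F hF; rewrite -(ltr_nat R); apply: (lt_le_trans hF).
  by rewrite Wn1; apply: (edge_count_ge (k := k)) => //; apply: ltW.
apply: (le_trans T); apply: le_trans (lerD T1 T2) _.
have -> : w^-1 = eps / 4 by rewrite /w invf_div.
rewrite -/x; clear -x8; lra.
Qed.

End Lower.

Theorem theorem1 (R : realType) (p gamma : R) :
  0 < p < 1 ->
  Num.max 1 (2 * p) < gamma < 2 ->
  gamma * ln (2 / gamma) + (2 - gamma) * ln (2 / (2 - gamma))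
    = (2 - gamma) * ln (1 / (1 - p)) - (1 - gamma) * ln (1 / p) ->
  forall eps : R, 0 < eps ->
  exists N : nat, forall n : nat, (N <= n)%N ->
    1 - eps <= @Gnp_prob R n p (fun E =>
      `| (max_chordal E)%:R - gamma * n%:R * (ln n%:R / ln (1 / p)) |
        <= 10 * n%:R * (ln (ln n%:R) / ln (1 / p))).
Proof.
move=> p01 hgamma eqn eps e0.
have [q [lam [c [gE rc]]]] := rate_constants_exist p01 hgamma eqn.
have e2 : 0 < eps / 2 by rewrite divr_gt0.
have [A1 upper] := upper_asymp rc e2.
have [A2 lower] := lower_asymp rc e2.
have [N hN] := lnln_large (Num.max A1 A2).
exists N => n /hN[]; rewrite ge_max => /andP[hA1 hA2] ut tn.
have p01' : 0 <= p <= 1 by case/andP: p01 => /ltW -> /ltW ->.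
(* A deviation beyond the allowed one lies in one of the two tails, each of probability at most
   eps/2. *)
rewrite Gnp_probE lerBlDr -lerBlDl -Pr_compl.
apply: le_trans (Pr_le_or p01' _) _; last first.
  by rewrite [eps]splitr; apply: lerD (upper _ _ _ ut tn hA1) (lower _ _ _ ut tn hA2).
move=> F; rewrite -ltNge gE ltr_normr => /orP[h|h]; apply/orP; [left|right]; lra.
Qed.
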